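(* Let $\Re(b)<1$ and $a-b+1\in\mathbb{C}\setminus\mathbb{Z}_{\leqslant0}$, where $a,b\in\mathbb{C}$, and let $y\in\mathbb{C}$. Then $$\Phi_1[a,b;a-b+1;-1,y]=\frac{\Gamma(a-b+1)}{2\,\Gamma(a)}\left\{\frac{\Gamma(\frac a2)}{\Gamma(\frac a2-b+1)}\,{}_1F_2\left[\begin{matrix}\frac a2\\ \frac12,\ \frac a2-b+1\end{matrix};\frac{y^2}{4}\right]+\frac{\Gamma(\frac a2+\frac12)}{\Gamma(\frac a2-b+\frac32)}\,y\cdot{}_1F_2\left[\begin{matrix}\frac a2+\frac12\\ \frac32,\ \frac a2-b+\frac32\end{matrix};\frac{y^2}{4}\right]\right\}.$$
   Context: $(\alpha)_n=\Gamma(\alpha+n)/\Gamma(\alpha)$ is the Pochhammer symbol. The generalized hypergeometric function is $${}_pF_q\left[\begin{matrix}a_1,\dots,a_p\\ b_1,\dots,b_q\end{matrix};z\right]=\sum_{n=0}^{\infty}\frac{(a_1)_n\cdots(a_p)_n}{(b_1)_n\cdots(b_q)_n}\frac{z^n}{n!},$$ where $a_1,\dots,a_p\in\mathbb{C}$ and $b_1,\dots,b_q\in\mathbb{C}\setminus\mathbb{Z}_{\leqslant0}$. For $a,b\in\mathbb{C}$ and $c\in\mathbb{C}\setminus\mathbb{Z}_{\leqslant0}$, the Humbert function $\Phi_1$ is defined for $|x|<1$, $|y|<\infty$ by $$\Phi_1[a,b;c;x,y]=\sum_{m,n=0}^{\infty}\frac{(a)_{m+n}(b)_m}{(c)_{m+n}}\frac{x^m}{m!}\frac{y^n}{n!},$$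 and is continued analytically to $x\neq1$, $|\arg(1-x)|<\pi$, $|y|<\infty$ by $$\Phi_1[a,b;c;x,y]=\sum_{n=0}^{\infty}\frac{(a)_n}{(c)_n}\,{}_2F_1\left[\begin{matrix}a+n,b\\ c+n\end{matrix};x\right]\frac{y^n}{n!},$$ where ${}_2F_1$ denotes the principal branch of the Gauss hypergeometric function. *)

(* Defs.v *)
From Stdlib Require Import Reals List Factorial.
From Coquelicot Require Import Coquelicot.
Import ListNotations.
Open Scope C_scope.

Definition Cexp (z : C) : C :=
  RtoC (exp (Re z)) * (cos (Im z), sin (Im z)).

(* Limit of a complex sequence and sum of a complex series, taken
   componentwise; meaningful only when the limit, resp. the sum, exists. *)
Definition Clim_seq (u : nat -> C) : C :=
  (real (Lim_seq (fun n => Re (u n))), real (Lim_seq (fun n => Im (u n)))).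

Definition CSeries (u : nat -> C) : C :=
  (Series (fun n => Re (u n)), Series (fun n => Im (u n))).

Definition nonpos_int (z : C) : Prop := exists k : nat, z = RtoC (- INR k).

(* (alpha)_n as the product alpha (alpha+1) ... (alpha+n-1). It equals
   Gamma(alpha+n)/Gamma(alpha) off the nonpositive integers, and also covers
   numerator parameters that are nonpositive integers. *)
Fixpoint poch (alpha : C) (n : nat) : C :=
  match n with
  | O => 1
  | S m => poch alpha m * (alpha + INR m)
  end.

(* Euler's limit n! n^z / (z (z+1) ... (z+n)), which converges to Gamma(z) for
   every z outside the nonpositive integers. The value at a pole is
   irrelevant. *)
Definition Gamma (z : C) : C :=
  Clim_seq (fun n => INR (fact n) * Cexp (z * ln (INR n)) / poch z (S n)).

Definition Cprod (l : list C) : C := fold_right Cmult 1 l.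

Definition pFq (num den : list C) (z : C) : C :=
  CSeries (fun n =>
    Cprod (map (fun a => poch a n) num) / Cprod (map (fun b => poch b n) den)
    * (z ^ n / INR (fact n))).

(* C minus the ray [1, +oo), i.e. x <> 1 and |arg (1 - x)| < pi. *)
Definition cut_plane (x : C) : Prop := ~ (Im x = 0%R /\ (1 <= Re x)%R).

(* F a b c is the principal branch of the Gauss function 2F1[a, b; c; .]: the
   holomorphic function on the cut plane that is the sum of the hypergeometric
   series on the unit disc. This determines F a b c on the cut plane, which is
   connected. *)
Definition principal_2F1 (F : C -> C -> C -> C -> C) : Prop :=
  forall a b c : C, ~ nonpos_int c ->
    (forall x : C, cut_plane x ->
       @ex_derive C_AbsRing C_NormedModule (F a b c) x) /\
    (forall x : C, (Cmod x < 1)%R -> F a b c x = pFq [a; b] [c] x).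

(* The Humbert function Phi_1 on the domain of its continuation, x in the cut
   plane and y arbitrary, with F the principal branch of 2F1. Expanding F for
   |x| < 1 gives the double series in x and y. *)
Definition Phi1 (F : C -> C -> C -> C -> C) (a b c x y : C) : C :=
  CSeries (fun n =>
    poch a n / poch c n * F (a + INR n) b (c + INR n) x
    * (y ^ n / INR (fact n))).

(* Main.v *)
Require Import Defs.
From Stdlib Require Import Reals List Factorial Lra Lia.
From Coquelicot Require Import Coquelicot.
Import ListNotations.
Open Scope C_scope.

(** Put $c=a-b+1$. The coefficient of $y^n/n!$ in $\Phi_1[a,b;c;-1,y]$ is
    $T_n=\frac{(a)_n}{(c)_n}\,{}_2F_1[a+n,b;c+n;-1]$, and the parameters
    $a+n,b;c+n$ are again of Kummer's type, $c+n=(a+n)-b+1$.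

    The value at $-1$ is obtained from Pfaff's transformation
    ${}_2F_1[A,b;C;-z/(1-z)]=(1-z)^b\,{}_2F_1[b,C-A;C;z]$, which rearranges
    absolutely convergent series for $0<z<1/2$ (lemma [pfaff]). As
    $z\to1/2$ the argument on the left tends to $-1$, where the principal branch
    is continuous, while the series on the right is still inside its disc of
    convergence; hence
    ${}_2F_1[a+n,b;c+n;-1]=2^{-b}g(c+n)$ with $g(c)={}_2F_1[b,1-b;c;1/2]$
    ([principal_2F1_at_m1]).

    The function $g$ satisfies $c(c+1)g(c)=(c+b)(c+1-b)g(c+2)$ by creative
    telescoping ([bailey_rec]). This one recurrence is used twice. It says that
    $T_{n+2}/T_n=\frac{(a+n)/2}{(a+n)/2-b+1}$ ([humbert_coef_rec]), so the even
    and the odd coefficients are Pochhammer quotients and give the two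
    ${}_1F_2$ series. Iterated, together with $g(c+2N)\to1$, it turns $g(c)$ into
    an infinite product, which Euler's limit for $\Gamma$ evaluates
    ([kummer_gamma]); this determines $T_0$ and $T_1$.

    Finally every $T_n$ is continuous in $a$ as long as $c$ is not a nonpositive
    integer, and the series is dominated uniformly near each such $a$. So the
    left-hand side is continuous in $a$, and it is the limit of the right-hand
    side at the parameters where the latter is undefined. All interchanges of
    limits and sums are instances of [tannery]. *)

(** * Limits and series of complex numbers *)

Lemma filterlim_C {T} (F : (T -> Prop) -> Prop) {FF : Filter F} (f : T -> C) (l : C) :
  filterlim f F (locally l) <->
  forall eps : posreal, F (fun t => (Cmod (f t - l) < eps)%R).
Proof. exact (filterlim_locally_ball_norm (U := C_NormedModule) f l). Qed.

Lemma filterlim_Cplus {T} (F : (T -> Prop) -> Prop) {FF : Filter F} (f g : T -> C) (l m : C) :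
  filterlim f F (locally l) -> filterlim g F (locally m) ->
  filterlim (fun t => f t + g t) F (locally (l + m)).
Proof.
  intros Hf Hg.
  eapply filterlim_comp_2; [exact Hf|exact Hg|].
  exact (filterlim_plus (V := C_NormedModule) l m).
Qed.

Lemma filterlim_Cmult {T} (F : (T -> Prop) -> Prop) {FF : Filter F} (f g : T -> C) (l m : C) :
  filterlim f F (locally l) -> filterlim g F (locally m) ->
  filterlim (fun t => f t * g t) F (locally (l * m)).
Proof.
  intros Hf Hg.
  refine (@filterlim_comp_2 _ _ _ _ F
    (@locally (AbsRing_UniformSpace C_AbsRing) l) (locally m) _ FF f g Cmult _ _ _).
  - intros P HP; apply Hf, locally_C, HP.
  - exact Hg.
  - exact (filterlim_scal (V := C_NormedModule) l m).
Qed.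

Lemma filterlim_Cinv {T} (F : (T -> Prop) -> Prop) {FF : Filter F} (f : T -> C) (l : C) :
  l <> 0 -> filterlim f F (locally l) ->
  filterlim (fun t => / f t) F (locally (/ l)).
Proof.
  intros Hl Hf. pose proof (proj1 (filterlim_C F f l) Hf) as Hf'.
  apply (proj2 (filterlim_C _ _ _)); intros eps.
  assert (Hm : (0 < Cmod l)%R) by now apply Cmod_gt_0.
  assert (He : (0 < Rmin (Cmod l / 2) (eps * (Cmod l * (Cmod l / 2))))%R).
  { apply Rmin_glb_lt; [lra|]. apply Rmult_lt_0_compat; [apply cond_pos|nra]. }
  generalize (Hf' (mkposreal _ He)); apply filter_imp; simpl; intros t Ht.
  assert (H1 : (Cmod (f t - l) < Cmod l / 2)%R) by (eapply Rlt_le_trans; [exact Ht|apply Rmin_l]).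
  assert (H2 : (Cmod (f t - l) < eps * (Cmod l * (Cmod l / 2)))%R)
    by (eapply Rlt_le_trans; [exact Ht|apply Rmin_r]).
  assert (H3 : (Cmod l / 2 < Cmod (f t))%R).
  { assert (Cmod l <= Cmod (f t) + Cmod (- (f t - l)))%R; [|rewrite Cmod_opp in H; lra].
    eapply Rle_trans; [|apply Cmod_triangle]. right; f_equal; ring. }
  assert (Hft : f t <> 0) by (apply Cmod_gt_0; lra).
  replace (/ f t - / l) with (- (f t - l) / (f t * l)) by (field; auto).
  rewrite Cmod_div, Cmod_opp, Cmod_mult by now apply Cmult_neq_0.
  apply Rlt_div_l; [nra|].
  eapply Rlt_le_trans; [exact H2|]. pose proof (cond_pos eps).
  apply Rmult_le_compat_l; nra.
Qed.

Lemma filterlim_Cdiv {T} (F : (T -> Prop) -> Prop) {FF : Filter F} (f g : T -> C) (l m : C) :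
  m <> 0 -> filterlim f F (locally l) -> filterlim g F (locally m) ->
  filterlim (fun t => f t / g t) F (locally (l / m)).
Proof. intros Hm Hf Hg; apply filterlim_Cmult; auto; now apply filterlim_Cinv. Qed.

Lemma filterlim_C_unique {T} (F : (T -> Prop) -> Prop) {FF : ProperFilter F} (f : T -> C) (l m : C) :
  filterlim f F (locally l) -> filterlim f F (locally m) -> l = m.
Proof. exact (filterlim_locally_unique (V := C_NormedModule) f l m). Qed.

Lemma filterlim_components {T} (F : (T -> Prop) -> Prop) {FF : Filter F} (f : T -> C) (l : C) :
  filterlim f F (locally l) <->
  filterlim (fun t => Re (f t)) F (locally (Re l)) /\
  filterlim (fun t => Im (f t)) F (locally (Im l)).
Proof.
  rewrite !(filterlim_locally (F := F)). split.
  - intros H; split; intros eps; generalize (H eps); apply filter_imp; intros t Ht; apply Ht.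
  - intros [H1 H2] eps. generalize (filter_and _ _ (H1 eps) (H2 eps)).
    apply filter_imp; intros t [Ht1 Ht2]; split; assumption.
Qed.

Lemma filterlim_RtoC {T} (F : (T -> Prop) -> Prop) {FF : Filter F} (f : T -> R) (l : R) :
  filterlim f F (locally l) -> filterlim (fun t => RtoC (f t)) F (locally (RtoC l)).
Proof. intros H; apply (proj2 (filterlim_components _ _ _)); split; [exact H|apply filterlim_const]. Qed.

Lemma Re_sum_n (u : nat -> C) n : Re (sum_n u n) = sum_n (fun k => Re (u k)) n.
Proof. induction n; [now rewrite !sum_O|now rewrite !sum_Sn, <- IHn]. Qed.

Lemma Im_sum_n (u : nat -> C) n : Im (sum_n u n) = sum_n (fun k => Im (u k)) n.
Proof. induction n; [now rewrite !sum_O|now rewrite !sum_Sn, <- IHn]. Qed.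

Lemma is_series_components (u : nat -> C) (l : C) :
  is_series u l <->
  is_series (fun k => Re (u k)) (Re l) /\ is_series (fun k => Im (u k)) (Im l).
Proof.
  split.
  - intros H. apply (filterlim_components eventually (sum_n u) l) in H. destruct H as [H1 H2].
    split; [eapply filterlim_ext; [|exact H1]|eapply filterlim_ext; [|exact H2]];
      intros n; [apply Re_sum_n|apply Im_sum_n].
  - intros [H1 H2]. apply (filterlim_components eventually (sum_n u) l).
    split; [eapply filterlim_ext; [|exact H1]|eapply filterlim_ext; [|exact H2]];
      intros n; symmetry; [apply Re_sum_n|apply Im_sum_n].
Qed.

Lemma CSeries_unique (u : nat -> C) (l : C) : is_series u l -> CSeries u = l.
Proof.
  intros H; apply is_series_components in H; destruct H as [H1 H2].
  unfold CSeries. rewrite (is_series_unique _ _ H1), (is_series_unique _ _ H2).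
  now destruct l.
Qed.

Lemma Clim_seq_unique (u : nat -> C) (l : C) : filterlim u eventually (locally l) -> Clim_seq u = l.
Proof.
  intros H; apply filterlim_components in H; [|typeclasses eauto]. destruct H as [H1 H2].
  unfold Clim_seq.
  rewrite (is_lim_seq_unique (fun n => Re (u n)) (Re l) H1),
    (is_lim_seq_unique (fun n => Im (u n)) (Im l) H2).
  now destruct l.
Qed.

Lemma is_CSeries (u : nat -> C) (M : nat -> R) :
  ex_series M -> (forall n, (Cmod (u n) <= M n)%R) -> is_series u (CSeries u).
Proof.
  intros HM Hu. destruct (ex_series_le (V := C_CompleteNormedModule) u M Hu HM) as [l Hl].
  now rewrite (CSeries_unique u l Hl).
Qed.

Lemma CSeries_ext (u v : nat -> C) : (forall n, u n = v n) -> CSeries u = CSeries v.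
Proof.
  intros H; unfold CSeries. f_equal; apply Series_ext; intros n; now rewrite H.
Qed.

Lemma Cmod_sum_n (u : nat -> C) n : (Cmod (sum_n u n) <= sum_n (fun k => Cmod (u k)) n)%R.
Proof. exact (norm_sum_n_m (V := C_NormedModule) u 0 n). Qed.

Lemma filterlim_Cmod_le {T} (F : (T -> Prop) -> Prop) {FF : ProperFilter F} (f : T -> C) (l : C) B :
  F (fun t => (Cmod (f t) <= B)%R) -> filterlim f F (locally l) -> (Cmod l <= B)%R.
Proof.
  intros HB Hf. apply le_epsilon; intros eps Heps.
  pose proof (proj1 (filterlim_C F f l) Hf (mkposreal eps Heps)) as H.
  destruct (filter_ex _ (filter_and _ _ HB H)) as [t [H1 H2]]; simpl in H2.
  replace l with (f t + - (f t - l)) by ring.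
  eapply Rle_trans; [apply Cmod_triangle|]. rewrite Cmod_opp. lra.
Qed.

Lemma sum_n_le_Series (M : nat -> R) N :
  ex_series M -> (forall n, (0 <= M n)%R) -> (sum_n M N <= Series M)%R.
Proof.
  intros HM H0. pose proof (Series_correct _ HM) as H.
  apply (is_lim_seq_incr_compare (sum_n M) (Series M) H).
  intros n; rewrite sum_Sn. unfold plus; simpl. specialize (H0 (S n)). lra.
Qed.

Lemma CSeries_bound (u : nat -> C) (M : nat -> R) :
  ex_series M -> (forall n, (Cmod (u n) <= M n)%R) -> (Cmod (CSeries u) <= Series M)%R.
Proof.
  intros HM Hu. apply (filterlim_Cmod_le eventually (sum_n u)); [|exact (is_CSeries u M HM Hu)].
  exists 0%nat; intros n _. eapply Rle_trans; [apply Cmod_sum_n|].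
  eapply Rle_trans; [apply sum_n_m_le; exact Hu|].
  apply sum_n_le_Series; auto. intros k; eapply Rle_trans; [apply Cmod_ge_0|apply Hu].
Qed.

Lemma CSeries_tail (u : nat -> C) (M : nat -> R) N :
  ex_series M -> (forall n, (Cmod (u n) <= M n)%R) ->
  (Cmod (CSeries u - sum_n u N) <= Series M - sum_n M N)%R.
Proof.
  intros HM Hu.
  apply (filterlim_Cmod_le eventually (fun n => sum_n u n - sum_n u N)).
  - exists N; intros n Hn.
    assert (H : (Cmod (sum_n u n - sum_n u N) <= sum_n M n - sum_n M N)%R).
    { induction Hn as [|n Hn IH].
      - replace (sum_n u N - sum_n u N) with (RtoC 0) by (unfold Cminus; now rewrite Cplus_opp_r).
        rewrite Cmod_0; lra.
      - rewrite !sum_Sn. unfold plus; simpl.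
        replace (sum_n u n + u (S n) - sum_n u N) with ((sum_n u n - sum_n u N) + u (S n)).
        2: { unfold Cminus. rewrite <- !Cplus_assoc. f_equal. apply Cplus_comm. }
        eapply Rle_trans; [apply Cmod_triangle|]. specialize (Hu (S n)). lra. }
    eapply Rle_trans; [exact H|]. apply Rplus_le_compat_r, sum_n_le_Series; auto.
    intros k; eapply Rle_trans; [apply Cmod_ge_0|apply Hu].
  - exact (filterlim_Cplus _ _ _ _ _ (is_CSeries u M HM Hu) (filterlim_const _)).
Qed.

Lemma filterlim_sum_n {T} (F : (T -> Prop) -> Prop) {FF : Filter F} (f : nat -> T -> C) (l : nat -> C) N :
  (forall n, filterlim (f n) F (locally (l n))) ->
  filterlim (fun t => sum_n (fun n => f n t) N) F (locally (sum_n l N : C)).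
Proof.
  intros H; induction N.
  - rewrite sum_O. eapply filterlim_ext; [|apply H]. intros t; now rewrite sum_O.
  - rewrite sum_Sn. eapply filterlim_ext; [|exact (filterlim_Cplus F _ _ _ _ IHN (H (S N)))].
    intros t; now rewrite sum_Sn.
Qed.

(** Dominated convergence for series: cut at an index past which the majorant has
    a small tail, and use termwise convergence below it. The filter is arbitrary
    because indices, real arguments and complex parameters all occur below. *)
Lemma tannery {T} (F : (T -> Prop) -> Prop) {FF : ProperFilter F}
    (f : nat -> T -> C) (l : nat -> C) (M : nat -> R) :
  ex_series M -> F (fun t => forall n, (Cmod (f n t) <= M n)%R) ->
  (forall n, filterlim (f n) F (locally (l n))) ->
  filterlim (fun t => CSeries (fun n => f n t)) F (locally (CSeries l)).
Proof.
  intros HM Hb Hl.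
  assert (Hlb : forall n, (Cmod (l n) <= M n)%R).
  { intros n. apply (filterlim_Cmod_le F (f n)); [|apply Hl].
    generalize Hb; apply filter_imp; auto. }
  apply (proj2 (filterlim_C _ _ _)); intros eps.
  assert (He : (0 < eps / 3)%R) by (pose proof (cond_pos eps); lra).
  destruct (proj1 (filterlim_locally _ _) (Series_correct _ HM) (mkposreal _ He)) as [N HN].
  specialize (HN N (Nat.le_refl N)).
  assert (HN' : (Series M - sum_n M N < eps / 3)%R).
  { change (Rabs (sum_n M N - Series M) < eps / 3)%R in HN.
    apply Rabs_def2 in HN. lra. }
  generalize (filter_and _ _ Hb
    (proj1 (filterlim_C F _ _) (filterlim_sum_n F f l N Hl) (mkposreal _ He))).
  apply filter_imp; simpl; intros t [Ht1 Ht2].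
  pose proof (CSeries_tail _ M N HM Ht1) as T1.
  pose proof (CSeries_tail _ M N HM Hlb) as T2.
  set (a := CSeries (fun n => f n t)) in *. set (b := CSeries l) in *.
  set (p := sum_n (fun n => f n t) N : C) in *. set (q := sum_n l N : C) in *.
  replace (a - b) with ((a - p) + ((p - q) + - (b - q))) by (unfold Cminus; ring).
  eapply Rle_lt_trans; [apply Cmod_triangle|].
  eapply Rle_lt_trans; [apply Rplus_le_compat_l, Cmod_triangle|].
  rewrite Cmod_opp. lra.
Qed.

Lemma sum_n_triangle (e : nat -> nat -> C) N :
  sum_n (fun n => sum_n (fun j => e j (n - j)%nat) n) N
  = sum_n (fun j => sum_n (e j) (N - j)) N :> C.
Proof.
  induction N; [now rewrite !sum_O|].
  rewrite sum_Sn, IHN, !(sum_Sn _ N), Nat.sub_diag, sum_O.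
  rewrite (plus_assoc (G := C_AbelianGroup)), <- (sum_n_plus (G := C_AbelianGroup)).
  f_equal. apply sum_n_ext_loc; intros j Hj.
  replace (S N - j)%nat with (S (N - j)) by lia. now rewrite sum_Sn.
Qed.

Lemma CSeries_finite (u : nat -> C) N :
  CSeries (fun n => if Nat.leb n N then u n else 0) = sum_n u N.
Proof.
  apply CSeries_unique. apply (filterlim_ext_loc (fun _ => sum_n u N)).
  2: apply filterlim_const.
  exists N; intros n Hn. induction Hn as [|n Hn IH].
  - apply sum_n_ext_loc; intros k Hk. now rewrite (proj2 (Nat.leb_le k N) Hk).
  - rewrite sum_Sn, <- IH, (proj2 (Nat.leb_gt (S n) N)) by lia.
    symmetry; apply (plus_zero_r (G := C_AbelianGroup)).
Qed.

(** The triangular partial sums are series in $j$ whose $j$-th term is a partial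
    sum of the $j$-th row, or $0$; so Tannery's theorem applies as $N\to\infty$. *)
Lemma CSeries_diagonal (e : nat -> nat -> C) (a : nat -> C) (M : nat -> R) :
  ex_series M -> (forall j N, (Cmod (sum_n (e j) N) <= M j)%R) ->
  (forall j, is_series (e j) (a j)) ->
  is_series (fun n => sum_n (fun j => e j (n - j)%nat) n : C) (CSeries a).
Proof.
  intros HM Hb Ha.
  apply (filterlim_ext (fun N => CSeries (fun j => if Nat.leb j N then sum_n (e j) (N - j) : C else 0))).
  { intros N. rewrite CSeries_finite. symmetry. apply sum_n_triangle. }
  apply (tannery eventually (fun j N => if Nat.leb j N then sum_n (e j) (N - j) : C else 0) a M HM).
  - exists 0%nat; intros N _ j. destruct (Nat.leb j N); [apply Hb|].
    rewrite Cmod_0. eapply Rle_trans; [apply Cmod_ge_0|apply (Hb j 0%nat)].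
  - intros j. apply (filterlim_ext_loc (fun N => sum_n (e j) (N - j) : C)).
    { exists j; intros n Hn. now rewrite (proj2 (Nat.leb_le j n) Hn). }
    eapply filterlim_comp; [|exact (Ha j)].
    intros P [n0 Hn0]; exists (n0 + j)%nat; intros n Hn; apply Hn0; lia.
Qed.

(** * Pochhammer symbols and their majorants *)

Lemma INR_S_C n : RtoC (INR (S n)) = INR n + 1.
Proof. now rewrite S_INR, RtoC_plus. Qed.

Lemma Cmult_reg_l (k u v : C) : k <> 0 -> k * u = k * v -> u = v.
Proof. intros Hk E. replace u with (/ k * (k * u)) by (field; auto). rewrite E. field; auto. Qed.

Lemma poch_add a n m : poch a (n + m) = poch a n * poch (a + INR n) m.
Proof.
  induction m as [|m IH]; [rewrite Nat.add_0_r; simpl; ring|].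
  rewrite Nat.add_succ_r; cbn [poch]. rewrite IH, plus_INR, RtoC_plus; ring.
Qed.

Lemma poch_Sl a n : poch a (S n) = a * poch (a + 1) n.
Proof.
  change (S n) with (1 + n)%nat. rewrite poch_add. cbn [poch]. change (INR 1) with 1%R.
  change (INR 0) with 0%R. ring.
Qed.

Lemma nonpos_int_shift c n : ~ nonpos_int c -> ~ nonpos_int (c + INR n).
Proof.
  intros H [k Hk]; apply H; exists (n + k)%nat.
  rewrite plus_INR, Ropp_plus_distr, RtoC_plus, <- Hk, RtoC_opp; ring.
Qed.

Lemma nonpos_int_nz c n : ~ nonpos_int c -> c + INR n <> 0.
Proof.
  intros H E; apply H; exists n. rewrite RtoC_opp.
  replace c with (c + INR n - INR n) by ring. rewrite E; ring.
Qed.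

Lemma nonpos_int_neq0 c : ~ nonpos_int c -> c <> 0.
Proof. intros H E; apply H; exists 0%nat; rewrite E; simpl; now rewrite Ropp_0. Qed.

Lemma poch_nz c n : ~ nonpos_int c -> poch c n <> 0.
Proof.
  intros H; induction n; cbn [poch]; [apply C1_nz|].
  apply Cmult_neq_0; [assumption|now apply nonpos_int_nz].
Qed.

Lemma fact_nz n : RtoC (INR (fact n)) <> 0.
Proof. intros E; apply RtoC_inj in E; exact (INR_fact_neq_0 n E). Qed.

Lemma INR_S_nz n : RtoC (INR (S n)) <> 0.
Proof. intros E; apply RtoC_inj in E; now apply (not_0_INR (S n)). Qed.

Lemma fact_S_C n : RtoC (INR (fact (S n))) = (INR n + 1) * INR (fact n).
Proof. now rewrite fact_simpl, mult_INR, RtoC_mult, INR_S_C. Qed.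

Lemma poch_1 n : poch 1 n = INR (fact n).
Proof.
  induction n; [reflexivity|]. rewrite fact_S_C; cbn [poch]. rewrite IHn; ring.
Qed.

(** A lower bound for all the factors of $(c)_n$ at once, which is uniform for
    $c$ in a small disc and is inherited by $c+1, c+2, \dots$; the part linear
    in $j$ makes the majorants below have the right growth. *)
Definition far (d K : R) (c : C) : Prop :=
  forall j : nat, (Rmax d (INR j - K) <= Cmod (c + INR j))%R.

Lemma far_shift d K c n : far d K c -> far d K (c + INR n).
Proof.
  intros H j. replace (c + INR n + INR j) with (c + INR (n + j)) by (rewrite plus_INR, RtoC_plus; ring).
  eapply Rle_trans; [|apply H]. apply Rle_max_compat_l.
  rewrite plus_INR. pose proof (pos_INR n). lra.
Qed.

Lemma far_1 : far 1 0 1.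
Proof.
  intros j. rewrite <- RtoC_plus, Cmod_R. pose proof (pos_INR j).
  rewrite Rabs_pos_eq by lra. apply Rmax_lub; lra.
Qed.

Lemma Cmod_le_dist (c c' : C) : (Cmod c <= Cmod c' + Cmod (c' - c))%R.
Proof.
  replace c with (c' + - (c' - c)) at 1 by ring.
  eapply Rle_trans; [apply Cmod_triangle|]. rewrite Cmod_opp; lra.
Qed.

Lemma Cmod_plus_INR_ge c j : (INR j - Cmod c <= Cmod (c + INR j))%R.
Proof.
  pose proof (Cmod_le_dist (INR j) (c + INR j)) as H.
  replace (c + INR j - INR j) with c in H by ring.
  rewrite Cmod_R, Rabs_pos_eq in H by apply pos_INR. lra.
Qed.

Lemma far_locally c : ~ nonpos_int c ->
  exists d K, (0 < d)%R /\ (0 < K)%R /\ far d K c /\ locally c (far d K).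
Proof.
  intros Hc.
  assert (H : forall J, exists d, (0 < d)%R /\ forall j, (j < J)%nat -> (d <= Cmod (c + INR j))%R).
  { induction J as [|J [d [Hd IH]]].
    - exists 1%R; split; [lra|]. intros j Hj; lia.
    - pose proof (proj1 (Cmod_gt_0 _) (nonpos_int_nz c J Hc)) as HJ.
      exists (Rmin d (Cmod (c + INR J))); split; [now apply Rmin_glb_lt|].
      intros j Hj. destruct (Nat.eq_dec j J) as [->|Hne]; [apply Rmin_r|].
      eapply Rle_trans; [apply Rmin_l|]. apply IH; lia. }
  destruct (nfloor_ex (Cmod c) (Cmod_ge_0 c)) as [J [_ HJ]].
  destruct (H (J + 2)%nat) as [d [Hd Hj]].
  set (e := Rmin d 1).
  assert (He : (0 < e)%R) by (apply Rmin_glb_lt; lra).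
  assert (Hall : forall j, (e <= Cmod (c + INR j))%R).
  { intros j. destruct (Nat.lt_ge_cases j (J + 2)) as [Hlt|Hge].
    - eapply Rle_trans; [apply Rmin_l|now apply Hj].
    - eapply Rle_trans; [apply Rmin_r|]. eapply Rle_trans; [|apply Cmod_plus_INR_ge].
      apply le_INR in Hge. rewrite plus_INR in Hge. simpl in Hge. lra. }
  assert (Hloc : locally c (far (e / 2) (Cmod c + e))).
  { assert (He2 : (0 < e / 2)%R) by lra.
    generalize (proj1 (filterlim_C (locally c) (fun t => t) c) (filterlim_id _ _) (mkposreal _ He2)).
    apply filter_imp; simpl; intros t Ht j. apply Rmax_lub.
    - pose proof (Cmod_le_dist (c + INR j) (t + INR j)) as H1.
      replace (t + INR j - (c + INR j)) with (t - c) in H1 by ring.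
      specialize (Hall j). lra.
    - pose proof (Cmod_plus_INR_ge t j). pose proof (Cmod_le_dist t c) as H1.
      rewrite <- Cmod_opp in Ht. replace (- (t - c)) with (c - t) in Ht by ring. lra. }
  exists (e / 2)%R, (Cmod c + e)%R; repeat split; auto; [lra| |].
  - pose proof (Cmod_ge_0 c); lra.
  - exact (locally_singleton _ _ Hloc).
Qed.

Lemma far_not_nonpos d K c : (0 < d)%R -> far d K c -> ~ nonpos_int c.
Proof.
  intros Hd H [k Hk]. specialize (H k).
  replace (c + INR k) with (RtoC 0) in H by (rewrite Hk, RtoC_opp; ring).
  rewrite Cmod_0 in H. pose proof (Rmax_l d (INR k - K)). lra.
Qed.

Fixpoint rprod (m : nat -> R) (n : nat) : R :=
  match n with
  | O => 1
  | S k => rprod m k * m k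
  end.

Lemma rprod_pos m n : (forall j, (0 < m j)%R) -> (0 < rprod m n)%R.
Proof. intros H; induction n; simpl; [lra|]. now apply Rmult_lt_0_compat. Qed.

Lemma ex_series_rprod m (k : R) :
  (forall j, (0 < m j)%R) -> is_lim_seq m k -> (k < 1)%R -> ex_series (rprod m).
Proof.
  intros H0 Hm Hk.
  assert (Hp := fun n => rprod_pos m n H0).
  apply (ex_series_ext (fun n => Rabs (rprod m n))).
  { intros n; apply Rabs_pos_eq; now left. }
  apply (ex_series_DAlembert _ k Hk).
  - intros n; specialize (Hp n); lra.
  - eapply is_lim_seq_ext; [|exact Hm]. intros n. simpl.
    replace (rprod m n * m n / rprod m n)%R with (m n) by (field; specialize (Hp n); lra).
    symmetry; apply Rabs_pos_eq; now left.
Qed.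

Lemma rprod_mult m m' n : rprod (fun j => m j * m' j)%R n = (rprod m n * rprod m' n)%R.
Proof. induction n; simpl; [ring|rewrite IHn; ring]. Qed.

Lemma rprod_const q n : rprod (fun _ => q) n = (q ^ n)%R.
Proof. induction n; simpl; [ring|rewrite IHn; ring]. Qed.

(** Bounds $|a+j|/|c+j|$ for $|a|\le s$ and $c$ in the region [far d K]; the
    summand $1$ makes it positive, as the ratio test requires. *)
Definition ratio_majorant (s d K : R) (j : nat) : R :=
  ((s + 1 + INR j) / Rmax d (INR j - K))%R.

Lemma ratio_majorant_pos s d K j : (0 <= s)%R -> (0 < d)%R -> (0 < ratio_majorant s d K j)%R.
Proof.
  intros Hs Hd. pose proof (pos_INR j). pose proof (Rmax_l d (INR j - K)).
  apply Rdiv_lt_0_compat; lra.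
Qed.

Lemma is_lim_seq_ratio_majorant s d K : is_lim_seq (ratio_majorant s d K) 1%R.
Proof.
  assert (Hinf : is_lim_seq (fun j => INR j - K)%R p_infty).
  { eapply is_lim_seq_minus; [apply is_lim_seq_INR|apply is_lim_seq_const|reflexivity]. }
  apply (is_lim_seq_ext_loc (fun j => 1 + (s + 1 + K) * / (INR j - K))%R).
  - destruct (nfloor_ex (Rabs K + Rabs d + 1)) as [J [_ HJ]].
    { pose proof (Rabs_pos K); pose proof (Rabs_pos d); lra. }
    exists (J + 1)%nat; intros j Hj. apply le_INR in Hj. rewrite plus_INR in Hj; simpl in Hj.
    pose proof (Rle_abs K); pose proof (Rle_abs d); pose proof (Rabs_pos K); pose proof (Rabs_pos d).
    unfold ratio_majorant. rewrite Rmax_right by lra. field. lra.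
  - replace (Finite 1) with (Finite (1 + (s + 1 + K) * 0)) by (f_equal; ring).
    apply is_lim_seq_plus'; [apply is_lim_seq_const|].
    apply is_lim_seq_mult'; [apply is_lim_seq_const|].
    apply (is_lim_seq_inv _ p_infty Hinf). discriminate.
Qed.

Lemma Cmod_poch_le a s n : (Cmod a <= s)%R -> (Cmod (poch a n) <= rprod (fun j => s + INR j) n)%R.
Proof.
  intros Ha; induction n; cbn [poch rprod]; [rewrite Cmod_1; lra|].
  rewrite Cmod_mult. apply Rmult_le_compat; try apply Cmod_ge_0; auto.
  eapply Rle_trans; [apply Cmod_triangle|].
  rewrite Cmod_R, Rabs_pos_eq by apply pos_INR. lra.
Qed.

Lemma Cmod_poch_ratio_le a c s d K n :
  (Cmod a <= s)%R -> (0 < d)%R -> far d K c ->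
  (Cmod (poch a n / poch c n) <= rprod (ratio_majorant s d K) n)%R.
Proof.
  intros Ha Hd Hc. pose proof (far_not_nonpos d K c Hd Hc) as Hc'.
  induction n; cbn [poch rprod]; [replace (1 / 1) with (RtoC 1) by field; rewrite Cmod_1; lra|].
  pose proof (poch_nz c n Hc'). pose proof (nonpos_int_nz c n Hc').
  replace (poch a n * (a + INR n) / (poch c n * (c + INR n)))
    with ((poch a n / poch c n) * ((a + INR n) / (c + INR n))) by (field; auto).
  rewrite Cmod_mult. apply Rmult_le_compat; try apply Cmod_ge_0; auto.
  rewrite Cmod_div by auto. specialize (Hc n). pose proof (Rmax_l d (INR n - K)).
  apply Rmult_le_compat.
  - apply Cmod_ge_0.
  - left; apply Rinv_0_lt_compat; lra.
  - eapply Rle_trans; [apply Cmod_triangle|].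
    rewrite Cmod_R, Rabs_pos_eq by apply pos_INR. lra.
  - apply Rinv_le_contravar; lra.
Qed.

(** * The Gauss series *)

Definition gauss_term (a b c z : C) (n : nat) : C :=
  poch a n * poch b n / poch c n * (z ^ n / INR (fact n)).

Definition gauss (a b c z : C) : C := CSeries (gauss_term a b c z).

Lemma pFq_gauss a b c z : pFq [a; b] [c] z = gauss a b c z.
Proof.
  apply CSeries_ext; intros n. unfold gauss_term, Cprod; cbn [map fold_right].
  now rewrite !Cmult_1_r.
Qed.

Lemma gauss_term_0 a b c z : gauss_term a b c z 0 = 1.
Proof. unfold gauss_term; simpl. field. Qed.

Lemma gauss_term_S a b c z n : ~ nonpos_int c ->
  gauss_term a b c z (S n)
  = gauss_term a b c z n * ((a + INR n) * (b + INR n) * z / ((c + INR n) * (INR n + 1))).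
Proof.
  intros Hc. unfold gauss_term. rewrite fact_S_C, Cpow_S. cbn [poch].
  pose proof (poch_nz c n Hc). pose proof (nonpos_int_nz c n Hc).
  pose proof (fact_nz n). pose proof (INR_S_nz n) as H2. rewrite INR_S_C in H2.
  field; auto.
Qed.

(** The second factor bounds $(b)_n/n!=(b)_n/(1)_n$. *)
Definition gauss_majorant (s t d K r : R) (n : nat) : R :=
  rprod (fun j => ratio_majorant s d K j * (ratio_majorant t 1 0 j * r))%R n.

Lemma ex_series_gauss_majorant s t d K r :
  (0 <= s)%R -> (0 <= t)%R -> (0 < d)%R -> (0 < r < 1)%R ->
  ex_series (gauss_majorant s t d K r).
Proof.
  intros Hs Ht Hd Hr.
  apply (ex_series_rprod _ (1 * (1 * r))); [| |lra].
  - intros j. pose proof (ratio_majorant_pos s d K j Hs Hd).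
    pose proof (ratio_majorant_pos t 1 0 j Ht Rlt_0_1).
    apply Rmult_lt_0_compat; [assumption|]. apply Rmult_lt_0_compat; lra.
  - apply is_lim_seq_mult'; [apply is_lim_seq_ratio_majorant|].
    apply is_lim_seq_mult'; [apply is_lim_seq_ratio_majorant|apply is_lim_seq_const].
Qed.

Lemma Cmod_gauss_term_le a b c z s t d K r n :
  (Cmod a <= s)%R -> (Cmod b <= t)%R -> (0 < d)%R -> far d K c -> (Cmod z <= r)%R ->
  (Cmod (gauss_term a b c z n) <= gauss_majorant s t d K r n)%R.
Proof.
  intros Ha Hb Hd Hc Hz. unfold gauss_term, gauss_majorant.
  rewrite !rprod_mult, rprod_const.
  replace (poch a n * poch b n / poch c n * (z ^ n / INR (fact n)))
    with ((poch a n / poch c n) * ((poch b n / poch 1 n) * z ^ n)).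
  2: { rewrite poch_1. pose proof (poch_nz c n (far_not_nonpos d K c Hd Hc)).
       pose proof (fact_nz n). field; auto. }
  rewrite !Cmod_mult, Cmod_pow.
  assert (0 <= Cmod (poch b n / poch 1 n) * Cmod z ^ n)%R.
  { apply Rmult_le_pos; [apply Cmod_ge_0|apply pow_le, Cmod_ge_0]. }
  apply Rmult_le_compat; auto; try apply Cmod_ge_0; [now apply Cmod_poch_ratio_le|].
  apply Rmult_le_compat; auto; try apply Cmod_ge_0; [apply pow_le, Cmod_ge_0| |].
  - apply Cmod_poch_ratio_le; auto using far_1; lra.
  - apply pow_incr; split; auto; apply Cmod_ge_0.
Qed.

Lemma is_series_gauss a b c z : ~ nonpos_int c -> (Cmod z < 1)%R ->
  is_series (gauss_term a b c z) (gauss a b c z).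
Proof.
  intros Hc Hz. destruct (far_locally c Hc) as [d [K [Hd [_ [Hf _]]]]].
  pose proof (Cmod_ge_0 z).
  apply (is_CSeries _ (gauss_majorant (Cmod a) (Cmod b) d K ((Cmod z + 1) / 2))).
  - apply ex_series_gauss_majorant; auto; try apply Cmod_ge_0; lra.
  - intros n; apply Cmod_gauss_term_le; auto; lra.
Qed.

Lemma filterlim_gauss_term {T} (F : (T -> Prop) -> Prop) {FF : Filter F} a b c (f g : T -> C) (z : C) n :
  ~ nonpos_int c -> filterlim f F (locally c) -> filterlim g F (locally z) ->
  filterlim (fun t => gauss_term a b (f t) (g t) n) F (locally (gauss_term a b c z n)).
Proof.
  intros Hc Hf Hg. unfold gauss_term.
  apply filterlim_Cmult; [typeclasses eauto| |].
  - apply filterlim_Cdiv; [typeclasses eauto|now apply poch_nz|apply filterlim_const|].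
    induction n; cbn [poch]; [apply filterlim_const|].
    apply filterlim_Cmult; [typeclasses eauto|assumption|].
    apply filterlim_Cplus; [typeclasses eauto|assumption|apply filterlim_const].
  - apply filterlim_Cmult; [typeclasses eauto| |apply filterlim_const].
    induction n; cbn [Cpow]; [apply filterlim_const|].
    apply filterlim_Cmult; [typeclasses eauto|assumption|assumption].
Qed.

(** Serves to move the argument to $1/2$ for a fixed lower parameter, and to move the
    lower parameter for a fixed argument. *)
Lemma filterlim_gauss {T} (F : (T -> Prop) -> Prop) {FF : ProperFilter F} a b c (f g : T -> C) (z : C) r :
  ~ nonpos_int c -> filterlim f F (locally c) -> filterlim g F (locally z) ->
  (r < 1)%R -> F (fun t => Cmod (g t) <= r)%R ->
  filterlim (fun t => gauss a b (f t) (g t)) F (locally (gauss a b c z)).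
Proof.
  intros Hc Hf Hg Hr Hb. destruct (far_locally c Hc) as [d [K [Hd [_ [_ Hloc]]]]].
  apply (tannery F (fun n t => gauss_term a b (f t) (g t) n) (gauss_term a b c z)
    (gauss_majorant (Cmod a) (Cmod b) d K (Rmax r (1 / 2)))).
  - apply ex_series_gauss_majorant; auto; try apply Cmod_ge_0.
    split; [eapply Rlt_le_trans; [|apply Rmax_r]|apply Rmax_lub_lt]; lra.
  - assert (Hfar : F (fun t => far d K (f t))) by exact (Hf _ Hloc).
    generalize (filter_and _ _ Hb Hfar). apply filter_imp.
    intros t [H1 H2] n. apply Cmod_gauss_term_le; auto; try lra.
    eapply Rle_trans; [exact H1|apply Rmax_l].
  - intros n; apply filterlim_gauss_term; auto; typeclasses eauto.
Qed.

(** * The complex exponential and the binomial series *)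

Lemma Cexp_plus u v : Cexp (u + v) = Cexp u * Cexp v.
Proof.
  unfold Cexp. destruct u as [a b], v as [c d]. simpl.
  rewrite exp_plus, cos_plus, sin_plus. unfold RtoC, Cmult; simpl. f_equal; ring.
Qed.

Lemma Cexp_0 : Cexp 0 = 1.
Proof. unfold Cexp; simpl. rewrite exp_0, cos_0, sin_0. unfold RtoC, Cmult; simpl; f_equal; ring. Qed.

Lemma Cexp_opp u : Cexp u * Cexp (- u) = 1.
Proof. rewrite <- Cexp_plus, Cplus_opp_r. apply Cexp_0. Qed.

Lemma Cexp_nz u : Cexp u <> 0.
Proof. intros E. apply C1_nz. rewrite <- (Cexp_opp u), E; ring. Qed.

Lemma Cexp_RtoC (x : R) : Cexp x = exp x.
Proof. unfold Cexp; simpl. rewrite cos_0, sin_0. unfold RtoC, Cmult; simpl; f_equal; ring. Qed.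

Lemma Cexp_INR_mult n u : Cexp (INR n * u) = Cexp u ^ n.
Proof.
  induction n; [simpl; rewrite Cmult_0_l; apply Cexp_0|].
  rewrite INR_S_C, Cpow_S, <- IHn, <- Cexp_plus. f_equal; ring.
Qed.

Definition binomial_term (a z : C) (n : nat) : C := poch a n / INR (fact n) * z ^ n.

Lemma binomial_term_gauss a z n : binomial_term a z n = gauss_term a 1 1 z n.
Proof.
  unfold binomial_term, gauss_term. rewrite poch_1. pose proof (fact_nz n). field; auto.
Qed.

Lemma binomial_CV_radius (p : nat -> R) a :
  (forall n, (Rabs (p n) <= Cmod (poch a n / INR (fact n)))%R) ->
  forall z, (Rabs z < 1)%R -> Rbar_lt (Rabs z) (CV_radius p).
Proof.
  intros Hp z Hz. set (r := ((Rabs z + 1) / 2)%R).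
  pose proof (Rabs_pos z). assert (Hr : (0 < r < 1)%R) by (unfold r; lra).
  apply Rbar_lt_le_trans with r; [simpl; unfold r; lra|].
  unfold CV_radius. destruct (Lub_Rbar_correct (CV_disk p)) as [Hub _]. apply Hub.
  unfold CV_disk. apply (@ex_series_le R_AbsRing R_CompleteNormedModule _
    (gauss_majorant (Cmod a) (Cmod 1) 1 0 r)).
  2: { apply ex_series_gauss_majorant; auto using Cmod_ge_0; lra. }
  intros n. change norm with Rabs. rewrite Rabs_Rabsolu, Rabs_mult.
  eapply Rle_trans; [|apply (Cmod_gauss_term_le a 1 1 r); try lra; auto using far_1].
  - rewrite <- binomial_term_gauss. unfold binomial_term.
    rewrite Cmod_mult, Cmod_pow, Cmod_R, RPow_abs.
    apply Rmult_le_compat_r; [apply Rabs_pos|apply Hp].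
  - rewrite Cmod_R, Rabs_pos_eq; lra.
Qed.

(** The sum $f$ solves $(1-z)f'=af$, so $f\cdot(1-z)^a$ is constant. The equation
    is written for the real and imaginary parts of $f$, which are real power
    series. *)
Lemma binomial_series (a : C) (z : R) : (0 <= z < 1)%R ->
  is_series (binomial_term a z) (Cexp (- a * ln (1 - z))).
Proof.
  intros Hz.
  set (p := fun n => Re (poch a n / INR (fact n))).
  set (q := fun n => Im (poch a n / INR (fact n))).
  assert (Hp : forall t, (Rabs t < 1)%R -> Rbar_lt (Rabs t) (CV_radius p)).
  { apply (binomial_CV_radius p a). intros n; apply re_le_Cmod. }
  assert (Hq : forall t, (Rabs t < 1)%R -> Rbar_lt (Rabs t) (CV_radius q)).
  { apply (binomial_CV_radius q a). intros n.
    eapply Rle_trans; [apply Rmax_r|apply Rmax_Cmod]. }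
  assert (Hrec : forall n, INR (S n) * (poch a (S n) / INR (fact (S n)))
                   = (a + INR n) * (poch a n / INR (fact n))).
  { intros n. cbn [poch]. rewrite fact_S_C, INR_S_C.
    pose proof (fact_nz n). pose proof (INR_S_nz n) as H2. rewrite INR_S_C in H2. field; auto. }
  assert (HRe : forall (s t : R) (u v w : C), s * u = (w + t) * v ->
    (Re u * s = Re w * Re v - Im w * Im v + t * Re v)%R /\
    (Im u * s = Im w * Re v + Re w * Im v + t * Im v)%R).
  { intros s t [u1 u2] [v1 v2] [w1 w2] E; injection E; intros E1 E2; simpl in *; split; lra. }
  assert (Hp' : forall n, PS_derive p n = (Re a * p n - Im a * q n + INR n * p n)%R).
  { intros n. unfold PS_derive, p, q. rewrite Rmult_comm. exact (proj1 (HRe _ _ _ _ _ (Hrec n))). }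
  assert (Hq' : forall n, PS_derive q n = (Im a * p n + Re a * q n + INR n * q n)%R).
  { intros n. unfold PS_derive, p, q. rewrite Rmult_comm. exact (proj2 (HRe _ _ _ _ _ (Hrec n))). }
  assert (Hinc : forall (c : nat -> R) n, PS_incr_1 (PS_derive c) n = (INR n * c n)%R).
  { intros c [|n]; [simpl; unfold zero; simpl; ring|reflexivity]. }
  (* The term n p_n of the coefficient recurrence sums to t p'(t), which moves to
     the left-hand side. *)
  assert (Hode : forall t, (Rabs t < 1)%R ->
    ((1 - t) * Derive (PSeries p) t = Re a * PSeries p t - Im a * PSeries q t)%R /\
    ((1 - t) * Derive (PSeries q) t = Im a * PSeries p t + Re a * PSeries q t)%R).
  { intros t Ht. rewrite !Derive_PSeries by auto.
    assert (Cp : ex_pseries p t) by (apply CV_radius_inside; auto).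
    assert (Cq : ex_pseries q t) by (apply CV_radius_inside; auto).
    assert (Cp' : ex_pseries (PS_incr_1 (PS_derive p)) t).
    { apply CV_radius_inside. rewrite CV_radius_incr_1, CV_radius_derive. auto. }
    assert (Cq' : ex_pseries (PS_incr_1 (PS_derive q)) t).
    { apply CV_radius_inside. rewrite CV_radius_incr_1, CV_radius_derive. auto. }
    assert (Dp : PSeries (PS_derive p) t =
      (Re a * PSeries p t - Im a * PSeries q t + t * PSeries (PS_derive p) t)%R).
    { rewrite <- (PSeries_incr_1 (PS_derive p)), <- !PSeries_scal.
      rewrite <- PSeries_minus, <- PSeries_plus; auto.
      - apply PSeries_ext; intros n. rewrite Hp'.
        unfold PS_plus, PS_minus, PS_opp, PS_scal. rewrite Hinc. reflexivity.
      - apply ex_pseries_minus; apply ex_pseries_scal; auto; apply Rmult_comm.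
      - apply ex_pseries_scal; auto; apply Rmult_comm.
      - apply ex_pseries_scal; auto; apply Rmult_comm. }
    assert (Dq : PSeries (PS_derive q) t =
      (Im a * PSeries p t + Re a * PSeries q t + t * PSeries (PS_derive q) t)%R).
    { rewrite <- (PSeries_incr_1 (PS_derive q)), <- !PSeries_scal.
      rewrite <- !PSeries_plus; auto.
      - apply PSeries_ext; intros n. rewrite Hq'.
        unfold PS_plus, PS_scal. rewrite Hinc. reflexivity.
      - apply ex_pseries_plus; apply ex_pseries_scal; auto; apply Rmult_comm.
      - apply ex_pseries_scal; auto; apply Rmult_comm.
      - apply ex_pseries_scal; auto; apply Rmult_comm. }
    split; lra. }
  set (f := fun t => (PSeries p t, PSeries q t) : C).
  assert (Hconst : f z * Cexp (a * ln (1 - z)) = 1).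
  { assert (H0 : f 0%R * Cexp (a * ln (1 - 0)) = 1).
    { rewrite Rminus_0_r, ln_1, Cmult_0_r, Cexp_0, Cmult_1_r.
      unfold f. rewrite !PSeries_0. unfold p, q.
      replace (poch a 0 / INR (fact 0)) with (RtoC 1) by (simpl; field). reflexivity. }
    destruct (Req_dec z 0) as [->|Hz0]; [exact H0|].
    rewrite <- H0.
    assert (Hre : forall t, Re (a * ln (1 - t)) = (Re a * ln (1 - t))%R /\
      Im (a * ln (1 - t)) = (Im a * ln (1 - t))%R).
    { intros t; unfold Re, Im; split; simpl; ring. }
    assert (Hd : forall t, (0 <= t <= z)%R -> (Rabs t < 1)%R) by (intros; rewrite Rabs_pos_eq; lra).
    symmetry. apply injective_projections.
    - apply (eq_is_derive (fun t => fst (f t * Cexp (a * ln (1 - t)))) 0 z); [|lra].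
      intros t Ht. destruct (Hode t (Hd t Ht)) as [O1 O2].
      pose proof (ex_derive_PSeries p t (Hp t (Hd t Ht))).
      pose proof (ex_derive_PSeries q t (Hq t (Hd t Ht))).
      apply (is_derive_ext (fun t => exp (Re a * ln (1 - t)) *
        (PSeries p t * cos (Im a * ln (1 - t)) - PSeries q t * sin (Im a * ln (1 - t))))%R).
      { intros s. unfold Cexp. rewrite (proj1 (Hre s)), (proj2 (Hre s)). simpl. ring. }
      auto_derive; [repeat split; auto; lra|].
      match goal with |- ?l = _ => change (l = 0%R :> R) end.
      match goal with |- ?l = _ => replace l with
       (exp (Re a * ln (1 - t)) / (1 - t) *
         (((1 - t) * Derive (PSeries p) t - (Re a * PSeries p t - Im a * PSeries q t))
           * cos (Im a * ln (1 - t))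
         - ((1 - t) * Derive (PSeries q) t - (Im a * PSeries p t + Re a * PSeries q t))
           * sin (Im a * ln (1 - t))))%R
      end.
      { rewrite O1, O2; ring. }
      change (fun x : R => PSeries p x) with (PSeries p).
      change (fun x : R => PSeries q x) with (PSeries q).
      unfold Rminus, Rdiv. field; lra.
    - apply (eq_is_derive (fun t => snd (f t * Cexp (a * ln (1 - t)))) 0 z); [|lra].
      intros t Ht. destruct (Hode t (Hd t Ht)) as [O1 O2].
      pose proof (ex_derive_PSeries p t (Hp t (Hd t Ht))).
      pose proof (ex_derive_PSeries q t (Hq t (Hd t Ht))).
      apply (is_derive_ext (fun t => exp (Re a * ln (1 - t)) *
        (PSeries p t * sin (Im a * ln (1 - t)) + PSeries q t * cos (Im a * ln (1 - t))))%R).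
      { intros s. unfold Cexp. rewrite (proj1 (Hre s)), (proj2 (Hre s)). simpl. ring. }
      auto_derive; [repeat split; auto; lra|].
      match goal with |- ?l = _ => change (l = 0%R :> R) end.
      match goal with |- ?l = _ => replace l with
       (exp (Re a * ln (1 - t)) / (1 - t) *
         (((1 - t) * Derive (PSeries p) t - (Re a * PSeries p t - Im a * PSeries q t))
           * sin (Im a * ln (1 - t))
         + ((1 - t) * Derive (PSeries q) t - (Im a * PSeries p t + Re a * PSeries q t))
           * cos (Im a * ln (1 - t))))%R
      end.
      { rewrite O1, O2; ring. }
      change (fun x : R => PSeries p x) with (PSeries p).
      change (fun x : R => PSeries q x) with (PSeries q).
      unfold Rminus, Rdiv. field; lra. }
  replace (Cexp (- a * ln (1 - z))) with (f z).
  2: { rewrite <- (Cmult_1_r (f z)), <- (Cexp_opp (a * ln (1 - z))), Cmult_assoc, Hconst, Cmult_1_l.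
       f_equal; ring. }
  assert (HS : CSeries (binomial_term a z) = f z).
  { unfold CSeries, f, PSeries. f_equal; apply Series_ext; intros n; unfold binomial_term, p, q;
    rewrite <- RtoC_pow; simpl; ring. }
  rewrite <- HS.
  apply (is_CSeries _ (gauss_majorant (Cmod a) (Cmod 1) 1 0 ((z + 1) / 2))).
  - apply ex_series_gauss_majorant; auto using Cmod_ge_0; lra.
  - intros n. rewrite binomial_term_gauss. apply Cmod_gauss_term_le; auto using far_1; try lra.
    rewrite Cmod_R, Rabs_pos_eq; lra.
Qed.

(* Equalities produced by the algebraic hierarchy carry a projection of a
   structure on C as their type; field only accepts C itself. *)
Ltac eqC := match goal with |- @eq _ ?l ?r => change (@eq C l r) end.

(** * Pfaff's transformation *)

Definition vandermonde_term (a c : C) (n j : nat) : C :=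
  (-(1)) ^ j * (poch a j / poch c j) / (INR (fact j) * INR (fact (n - j))).

Lemma sum_n_S_C (u : nat -> C) n : sum_n u (S n) = Cplus (sum_n u n) (u (S n)).
Proof. exact (sum_Sn u n). Qed.

Lemma vandermonde_term_0 a c n :
  (INR n + 1) * vandermonde_term a c (S n) 0 = vandermonde_term a c n 0.
Proof.
  unfold vandermonde_term. rewrite !Nat.sub_0_r, fact_S_C. simpl.
  pose proof (fact_nz n). pose proof (INR_S_nz n) as Hn. rewrite INR_S_C in Hn. field; auto.
Qed.

Lemma vandermonde_term_S a c n j : ~ nonpos_int c -> (j < n)%nat ->
  (INR n + 1) * vandermonde_term a c (S n) (S j)
  = vandermonde_term a c n (S j) - a / c * vandermonde_term (a + 1) (c + 1) n j.
Proof.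
  intros Hc Hj. unfold vandermonde_term.
  assert (Hc1 : ~ nonpos_int (c + 1)) by exact (nonpos_int_shift c 1 Hc).
  pose proof (poch_nz (c + 1) j Hc1). pose proof (fact_nz j).
  pose proof (nonpos_int_neq0 c Hc). pose proof (INR_S_nz j) as Hj1. rewrite INR_S_C in Hj1.
  rewrite !(poch_Sl _ j), !(fact_S_C j), !(Cpow_S _ j), Nat.sub_succ.
  replace (n - j)%nat with (S (n - S j)) by lia. rewrite fact_S_C.
  set (k := (n - S j)%nat). pose proof (fact_nz k).
  assert (Hn : RtoC (INR n) = INR k + 1 + INR j).
  { rewrite <- INR_S_C, <- RtoC_plus, <- plus_INR. do 2 f_equal. unfold k; lia. }
  pose proof (INR_S_nz k) as Hk1. rewrite INR_S_C in Hk1.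
  rewrite Hn. field; repeat split; auto.
Qed.

Lemma vandermonde_term_last a c n : ~ nonpos_int c ->
  (INR n + 1) * vandermonde_term a c (S n) (S n)
  = - (a / c * vandermonde_term (a + 1) (c + 1) n n).
Proof.
  intros Hc. unfold vandermonde_term.
  assert (Hc1 : ~ nonpos_int (c + 1)) by exact (nonpos_int_shift c 1 Hc).
  pose proof (poch_nz (c + 1) n Hc1). pose proof (fact_nz n).
  pose proof (nonpos_int_neq0 c Hc). pose proof (INR_S_nz n) as Hn. rewrite INR_S_C in Hn.
  rewrite !(poch_Sl _ n), !(fact_S_C n), !(Cpow_S _ n), !Nat.sub_diag.
  simpl (fact 0). simpl (INR 1). field; repeat split; auto.
Qed.

(** Pascal's rule turns the sum for $(a,c,n+1)$ into those for $(a,c,n)$ and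
    $(a+1,c+1,n)$. *)
Lemma chu_vandermonde n : forall a c, ~ nonpos_int c ->
  sum_n (vandermonde_term a c n) n = poch (c - a) n / poch c n / INR (fact n) :> C.
Proof.
  induction n as [|n IH]; intros a c Hc.
  { rewrite sum_O. unfold vandermonde_term; simpl. field. }
  pose proof (INR_S_nz n) as Hn. rewrite INR_S_C in Hn.
  assert (Hc1 : ~ nonpos_int (c + 1)) by exact (nonpos_int_shift c 1 Hc).
  pose proof (nonpos_int_neq0 c Hc) as Hc0. pose proof (fact_nz n) as Hf.
  assert (E : forall m, (m <= n)%nat ->
    (INR n + 1) * sum_n (vandermonde_term a c (S n)) m
    = sum_n (vandermonde_term a c n) m
      - a / c * (sum_n (vandermonde_term (a + 1) (c + 1) n) m
                 - vandermonde_term (a + 1) (c + 1) n m)).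
  { induction m as [|m IHm]; intros Hm.
    - rewrite !sum_O, vandermonde_term_0. ring.
    - rewrite !sum_n_S_C, Cmult_plus_distr_l, IHm, vandermonde_term_S by (auto; lia). ring. }
  specialize (E n (Nat.le_refl n)).
  pose proof (vandermonde_term_last a c n Hc) as L.
  rewrite (IH a c Hc), (IH (a + 1) (c + 1) Hc1) in E.
  apply (Cmult_reg_l (INR n + 1) _ _ Hn).
  rewrite sum_n_S_C, Cmult_plus_distr_l, E, L.
  replace (c + 1 - (a + 1)) with (c - a) by ring.
  pose proof (poch_nz c n Hc) as H1. pose proof (poch_nz c (S n) Hc) as H2.
  pose proof (poch_nz (c + 1) n Hc1) as H3. pose proof (nonpos_int_nz c n Hc) as H4.
  assert (P : poch (c + 1) n = poch c n * (c + INR n) / c).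
  { pose proof (poch_Sl c n) as P. cbn [poch] in P. rewrite P. field; auto. }
  rewrite P, fact_S_C. cbn [poch]. field; repeat split; auto.
Qed.

Lemma sum_n_Cmod_binomial_term_le a s (z : R) N : (Cmod a <= s)%R -> (0 <= z < 1)%R ->
  (sum_n (fun m => Cmod (binomial_term a z m)) N <= exp (- s * ln (1 - z)))%R.
Proof.
  intros Ha Hz.
  set (u := fun m => (rprod (fun j => s + INR j) m / INR (fact m) * z ^ m)%R).
  assert (Hpoch : forall m, poch s m = rprod (fun j => s + INR j)%R m).
  { induction m; cbn [poch rprod]; [reflexivity|]. now rewrite IHm, RtoC_mult, RtoC_plus. }
  assert (Hu : is_series u (exp (- s * ln (1 - z)))).
  { pose proof (binomial_series s z Hz) as H. rewrite <- RtoC_opp, <- RtoC_mult, Cexp_RtoC in H.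
    apply is_series_components in H. eapply is_series_ext; [|exact (proj1 H)].
    intros m. unfold binomial_term, u. rewrite Hpoch, <- RtoC_pow, <- RtoC_div, <- RtoC_mult; [reflexivity|].
    apply INR_fact_neq_0. }
  assert (Hle : forall m, (Cmod (binomial_term a z m) <= u m)%R).
  { intros m. unfold binomial_term, u. rewrite Cmod_mult, Cmod_pow, Cmod_div by apply fact_nz.
    rewrite !Cmod_R, (Rabs_pos_eq z), (Rabs_pos_eq (INR (fact m))) by (apply pos_INR || lra).
    apply Rmult_le_compat_r; [apply pow_le; lra|].
    apply Rmult_le_compat_r; [left; apply Rinv_0_lt_compat, INR_fact_lt_0|].
    now apply Cmod_poch_le. }
  rewrite <- (is_series_unique _ _ Hu).
  eapply Rle_trans; [apply sum_n_m_le; exact Hle|].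
  apply sum_n_le_Series; [eexists; exact Hu|].
  intros m; eapply Rle_trans; [apply Cmod_ge_0|apply Hle].
Qed.

(** Expand $(1-z)^{-b-j}$ in the $j$-th term of the left-hand side by the binomial
    series and sum along diagonals; the coefficient of $z^n$ is a Chu-Vandermonde
    sum. Replacing $b$ by $|b|$ in the inner expansion bounds its sum of absolute
    values by $(1-z)^{-|b|-j}$, so that the double series converges absolutely as
    soon as $z/(1-z)<1$, that is, for all arguments in $(-1,0)$. *)
Lemma pfaff a b c (z : R) : ~ nonpos_int c -> (0 < z < 1 / 2)%R ->
  gauss a b c (- z / (1 - z))%R * Cexp (- b * ln (1 - z)) = gauss b (c - a) c z.
Proof.
  intros Hc Hz.
  set (e := fun j m => (-(1)) ^ j * (poch a j / poch c j) / INR (fact j)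
                       * (poch b (j + m) / INR (fact m)) * z ^ (j + m)).
  set (s := fun j => gauss_term a b c (- z / (1 - z))%R j * Cexp (- b * ln (1 - z))).
  assert (Hnz : RtoC (1 - z) <> 0) by (intros E; apply RtoC_inj in E; lra).
  assert (Hx : RtoC (- z / (1 - z))%R = - (1) * z * / RtoC (1 - z)).
  { rewrite RtoC_div, RtoC_opp by lra. field; auto. }
  assert (He : forall j m, e j m = (poch a j / poch c j * poch b j / INR (fact j))
             * ((-(1)) * z) ^ j * binomial_term (b + INR j) z m).
  { intros j m. unfold e, binomial_term. rewrite poch_add, Cpow_add_r, Cpow_mult_l.
    pose proof (fact_nz j). pose proof (fact_nz m). pose proof (poch_nz c j Hc). field; auto. }
  assert (Hs : forall j, s j = (poch a j / poch c j * poch b j / INR (fact j))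
             * ((-(1)) * z) ^ j * Cexp (- (b + INR j) * ln (1 - z))).
  { intros j. unfold s, gauss_term. rewrite Hx.
    replace (- (b + INR j) * ln (1 - z)) with (- b * ln (1 - z) + INR j * (- ln (1 - z))) by ring.
    rewrite Cexp_plus, Cexp_INR_mult.
    replace (Cexp (- ln (1 - z))) with (/ RtoC (1 - z)).
    2: { rewrite <- RtoC_opp, Cexp_RtoC, exp_Ropp, exp_ln by lra. now rewrite RtoC_inv by lra. }
    rewrite (Cpow_mult_l (- (1) * z)).
    pose proof (fact_nz j). pose proof (poch_nz c j Hc). field; auto. }
  assert (Hs' : forall j, is_series (e j) (s j)).
  { intros j. rewrite Hs.
    apply (is_series_ext (fun m => scal ((poch a j / poch c j * poch b j / INR (fact j))
             * ((-(1)) * z) ^ j) (binomial_term (b + INR j) z m))).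
    { intros m; now rewrite He. }
    apply (is_series_scal (V := C_NormedModule)). apply binomial_series; lra. }
  set (M := fun j => (Cmod (gauss_term a b c (- z / (1 - z))%R j) * exp (- Cmod b * ln (1 - z)))%R).
  assert (Hxm : Cmod (- z / (1 - z))%R = (z / (1 - z))%R).
  { rewrite Cmod_R. replace (- z / (1 - z))%R with (- (z / (1 - z)))%R by (field; lra).
    rewrite Rabs_Ropp, Rabs_pos_eq; [reflexivity|]. apply Rdiv_le_0_compat; lra. }
  assert (Hx1 : (0 < z / (1 - z) < 1)%R).
  { split; [apply Rdiv_lt_0_compat; lra|apply Rlt_div_l; lra]. }
  assert (HM : ex_series M).
  { apply (ex_series_scal_r (exp (- Cmod b * ln (1 - z)))).
    destruct (far_locally c Hc) as [d [K [Hd [_ [Hf _]]]]].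
    apply (@ex_series_le R_AbsRing R_CompleteNormedModule _
      (gauss_majorant (Cmod a) (Cmod b) d K (z / (1 - z)))).
    - intros j. change norm with Rabs. rewrite Rabs_pos_eq by apply Cmod_ge_0.
      apply Cmod_gauss_term_le; auto; lra.
    - apply ex_series_gauss_majorant; auto using Cmod_ge_0. }
  assert (Hb : forall j N, (Cmod (sum_n (e j) N) <= M j)%R).
  { intros j N. eapply Rle_trans; [apply Cmod_sum_n|].
    unfold M, gauss_term.
    set (co := poch a j / poch c j * poch b j / INR (fact j)).
    replace (poch a j * poch b j / poch c j * (RtoC (- z / (1 - z))%R ^ j / INR (fact j)))
      with (co * RtoC (- z / (1 - z))%R ^ j).
    2: { unfold co. pose proof (fact_nz j). pose proof (poch_nz c j Hc). field; auto. }
    rewrite Cmod_mult, Cmod_pow, Hxm.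
    rewrite (sum_n_ext _ (fun m => (Cmod co * z ^ j) * Cmod (binomial_term (b + INR j) z m))%R).
    2: { intros m. rewrite He. fold co.
         rewrite !Cmod_mult, Cmod_pow, Cmod_mult, Cmod_opp, Cmod_1, Cmod_R, Rabs_pos_eq by lra.
         now rewrite Rmult_1_l. }
    rewrite (sum_n_mult_l (K := R_Ring)).
    replace (Cmod co * (z / (1 - z)) ^ j * exp (- Cmod b * ln (1 - z)))%R
      with (Cmod co * z ^ j * exp (- (Cmod b + INR j) * ln (1 - z)))%R.
    - apply Rmult_le_compat_l.
      + apply Rmult_le_pos; [apply Cmod_ge_0|apply pow_le; lra].
      + apply sum_n_Cmod_binomial_term_le; [|lra].
        eapply Rle_trans; [apply Cmod_triangle|]. rewrite Cmod_R, Rabs_pos_eq by apply pos_INR. lra.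
    - replace (- (Cmod b + INR j) * ln (1 - z))%R
        with (- Cmod b * ln (1 - z) + - (INR j * ln (1 - z)))%R by ring.
      rewrite exp_plus, exp_Ropp.
      replace (exp (INR j * ln (1 - z))) with ((1 - z) ^ j)%R.
      2: { rewrite <- Rpower_pow by lra. reflexivity. }
      unfold Rdiv. rewrite Rpow_mult_distr, pow_inv. ring. }
  transitivity (CSeries s).
  { symmetry. apply CSeries_unique. unfold s, gauss.
    apply (is_series_ext (fun n => scal (Cexp (- b * ln (1 - z))) (gauss_term a b c (- z / (1 - z))%R n))).
    { intros n; apply Cmult_comm. }
    rewrite (Cmult_comm (CSeries _)). apply (is_series_scal (V := C_NormedModule)).
    apply is_series_gauss; [assumption|]. rewrite Hxm; lra. }
  symmetry. apply CSeries_unique.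
  eapply is_series_ext; [|exact (CSeries_diagonal e s M HM Hb Hs')].
  intros n. unfold gauss_term. eqC.
  transitivity (poch b n * z ^ n * sum_n (vandermonde_term a c n) n).
  - etransitivity; [|exact (sum_n_mult_l (K := C_Ring) (poch b n * z ^ n) (vandermonde_term a c n) n)].
    apply sum_n_ext_loc; intros j Hj. unfold e, vandermonde_term.
    replace (j + (n - j))%nat with n by lia.
    match goal with |- ?l = mult ?u ?v => change (l = Cmult u v :> C) end. pose proof (fact_nz j). pose proof (fact_nz (n - j)).
    pose proof (poch_nz c j Hc). field; auto.
  - rewrite (chu_vandermonde n a c Hc). pose proof (fact_nz n). pose proof (poch_nz c n Hc). field; auto.
Qed.

(** * The value at $x=-1$ of the principal branch *)

(** Let $z$ increase to $1/2$ in Pfaff's transformation: $F$ is continuous at $-1$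
    because it is differentiable there, and inside the unit disc it is the series. *)
Lemma principal_2F1_at_m1 F a b c : principal_2F1 F -> ~ nonpos_int c ->
  F a b c (-1) = Cexp (- b * ln 2) * gauss b (c - a) c (1 / 2)%R.
Proof.
  intros HF Hc. destruct (HF a b c Hc) as [Hder Hser].
  assert (Hid : filterlim (fun z : R => z) (at_left (1 / 2)) (locally (1 / 2)%R)).
  { intros P HP. apply filter_le_within, HP. }
  assert (Hcont : forall (f : R -> R) (l : R), filterlim f (locally (1 / 2)%R) (locally l) ->
    filterlim f (at_left (1 / 2)) (locally l)).
  { intros f l Hf P HP. apply filter_le_within, Hf, HP. }
  assert (Hloc : at_left (1 / 2) (fun z => (0 < z < 1 / 2)%R)).
  { exists (mkposreal (1 / 2) ltac:(lra)). intros z Hz Hlt; split; [|exact Hlt].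
    apply Rabs_lt_between' in Hz; simpl in Hz; lra. }
  apply (filterlim_C_unique (at_left (1 / 2)) (fun z => F a b c (- z / (1 - z))%R)).
  - apply (filterlim_comp _ _ _ _ (F a b c) _
      (@locally (AbsRing_UniformSpace C_AbsRing) (RtoC (-1)))).
    + intros P HP. apply locally_C in HP.
      refine (filterlim_RtoC (at_left (1 / 2)) (fun z => - z / (1 - z))%R (-1) _ P HP).
      apply Hcont.
      replace (-1)%R with (- (1 / 2) / (1 - 1 / 2))%R by lra.
      apply (ex_derive_continuous (fun z => - z / (1 - z))%R). auto_derive. lra.
    + apply (ex_derive_continuous (F a b c)). apply Hder.
      intros [_ H]; simpl in H; lra.
  - apply (filterlim_ext_loc (fun z : R => Cexp (b * ln (1 - z)) * gauss b (c - a) c z)).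
    { revert Hloc; apply filter_imp; intros z Hz.
      rewrite Hser, pFq_gauss, <- (pfaff a b c z Hc Hz).
      2: { rewrite Cmod_R. replace (- z / (1 - z))%R with (- (z / (1 - z)))%R by (field; lra).
           rewrite Rabs_Ropp, Rabs_pos_eq; [apply Rlt_div_l; lra|apply Rdiv_le_0_compat; lra]. }
      replace (- b * ln (1 - z)) with (- (b * ln (1 - z))) by ring.
      rewrite Cmult_comm, <- Cmult_assoc, (Cmult_comm (Cexp (- _))), Cexp_opp. ring. }
    apply filterlim_Cmult; [typeclasses eauto| |].
    + replace (- b * ln 2) with (b * ln (1 - 1 / 2)).
      2: { replace (1 - 1 / 2)%R with (/ 2)%R by lra. rewrite ln_Rinv by lra. rewrite RtoC_opp; ring. }
      unfold Cexp. apply filterlim_components; [typeclasses eauto|]. simpl.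
      split; apply Hcont.
      * apply (ex_derive_continuous (fun x => exp (Re b * ln (1 - x) - Im b * 0) *
          cos (Re b * 0 + Im b * ln (1 - x)) - 0 * sin (Re b * 0 + Im b * ln (1 - x)))%R).
        auto_derive. lra.
      * apply (ex_derive_continuous (fun x => exp (Re b * ln (1 - x) - Im b * 0) *
          sin (Re b * 0 + Im b * ln (1 - x)) + 0 * cos (Re b * 0 + Im b * ln (1 - x)))%R).
        auto_derive. lra.
    + apply (filterlim_gauss (at_left (1 / 2)) b (c - a) c (fun _ => c) (fun z => RtoC z) (1 / 2)%R (1 / 2)).
      * assumption.
      * apply filterlim_const.
      * apply (filterlim_RtoC _ _ _ Hid).
      * lra.
      * revert Hloc; apply filter_imp; intros z Hz. rewrite Cmod_R, Rabs_pos_eq; lra.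
Qed.

(** * Bailey's theorem for ${}_2F_1[b,1-b;c;1/2]$ *)

Definition bailey (b c : C) : C := gauss b (1 - b) c (1 / 2)%R.

Lemma RtoC_half : RtoC (1 / 2)%R = / 2.
Proof. rewrite RtoC_div by lra. unfold Cdiv. ring. Qed.

Lemma C2_nz : RtoC 2 <> 0.
Proof. intros E; apply RtoC_inj in E; lra. Qed.

Lemma Cmod_half : Cmod (1 / 2)%R = (1 / 2)%R.
Proof. rewrite Cmod_R, Rabs_pos_eq; lra. Qed.

Lemma INR_2_C : RtoC (INR 2) = 2.
Proof. f_equal; simpl; ring. Qed.

Lemma poch_shift_2 c k :
  c * (c + 1) * poch (c + 2) k = poch c k * (c + INR k) * (c + INR k + 1).
Proof.
  pose proof (poch_add c 2 k) as H1. pose proof (poch_add c k 2) as H2.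
  rewrite Nat.add_comm, H2 in H1. cbn [poch] in H1. rewrite INR_2_C in H1. simpl INR in H1 at 2 5.
  transitivity (1 * (c + 0%R) * (c + INR 1) * poch (c + 2) k); [simpl; ring|].
  rewrite <- H1; simpl; ring.
Qed.

Lemma filterlim_gauss_term_0 a b c z : ~ nonpos_int c -> (Cmod z < 1)%R ->
  filterlim (gauss_term a b c z) eventually (locally (RtoC 0)).
Proof.
  intros Hc Hz. pose proof (is_series_gauss a b c z Hc Hz) as H.
  apply is_series_components in H. destruct H as [H1 H2].
  apply filterlim_components; [typeclasses eauto|]. split.
  - exact (ex_series_lim_0 _ (ex_intro _ _ H1)).
  - exact (ex_series_lim_0 _ (ex_intro _ _ H2)).
Qed.

(** Zeilberger's method: with $t_k$, $s_k$ the terms of the two series, the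
    combination $c(c+1)t_k-(c+b)(c+1-b)s_k$ is the difference $H_{k+1}-H_k$ of
    $H_k=-2c(c+1)\,k\,t_k/(c+k)$. *)
Lemma bailey_rec b c : ~ nonpos_int c ->
  c * (c + 1) * bailey b c = (c + b) * (c + 1 - b) * bailey b (c + 2).
Proof.
  intros Hc.
  assert (Hc2 : ~ nonpos_int (c + 2)) by (rewrite <- INR_2_C; now apply nonpos_int_shift).
  assert (Hc1 : ~ nonpos_int (c + 1)) by exact (nonpos_int_shift c 1 Hc).
  set (t := gauss_term b (1 - b) c (1 / 2)%R).
  set (s := gauss_term b (1 - b) (c + 2) (1 / 2)%R).
  (* k / (c + k), written so that it is visibly bounded *)
  set (H := fun k => - (2) * c * (c + 1) * (t k * (1 - c / (c + INR k)))).
  assert (Hs : forall k, s k = t k * (c * (c + 1)) / ((c + INR k) * (c + INR k + 1))).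
  { intros k. unfold s, t, gauss_term.
    pose proof (poch_nz (c + 2) k Hc2). pose proof (poch_nz c k Hc). pose proof (fact_nz k).
    pose proof (nonpos_int_nz c k Hc). pose proof (nonpos_int_nz (c + 1) k Hc1) as H5.
    replace (c + 1 + INR k) with (c + INR k + 1) in H5 by ring.
    pose proof (nonpos_int_neq0 c Hc). pose proof (nonpos_int_neq0 _ Hc1).
    replace (poch (c + 2) k) with (poch c k * (c + INR k) * (c + INR k + 1) / (c * (c + 1))).
    2: { rewrite <- poch_shift_2. field; auto. }
    field; repeat split; auto. }
  assert (Hsum : forall N, sum_n (fun k => c * (c + 1) * t k - (c + b) * (c + 1 - b) * s k) N = H (S N)).
  { assert (Hstep : forall k, H (S k) = H k + (c * (c + 1) * t k - (c + b) * (c + 1 - b) * s k)).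
    { intros k. unfold H. rewrite Hs. unfold t. rewrite gauss_term_S, INR_S_C, RtoC_half by assumption.
      pose proof (nonpos_int_nz c k Hc). pose proof (nonpos_int_nz (c + 1) k Hc1) as H5.
      replace (c + 1 + INR k) with (c + INR k + 1) in H5 by ring.
      pose proof (INR_S_nz k) as H6. rewrite INR_S_C in H6. pose proof C2_nz.
      field; repeat split; auto. }
    induction N.
    - rewrite sum_O, Hstep. unfold H. simpl INR. eqC.
      pose proof (nonpos_int_neq0 c Hc). field; auto.
    - rewrite sum_n_S_C, IHN, <- Hstep. reflexivity. }
  assert (HH : filterlim (fun N => H (S N)) eventually (locally (RtoC 0))).
  { apply (filterlim_comp _ _ _ S H eventually eventually); [apply eventually_subseq; intros; lia|].
    unfold H.
    assert (Ht : filterlim t eventually (locally (RtoC 0))).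
    { apply filterlim_gauss_term_0; auto. rewrite Cmod_half; lra. }
    destruct (far_locally c Hc) as [d [K [Hd [_ [Hf _]]]]].
    replace (RtoC 0) with (- (2) * c * (c + 1) * 0) by ring.
    apply filterlim_Cmult; [typeclasses eauto|apply filterlim_const|].
    apply (proj2 (filterlim_C _ _ _)); intros eps.
    set (B := (1 + Cmod c / d)%R).
    assert (HB : (0 < B)%R).
    { unfold B. pose proof (Rdiv_le_0_compat (Cmod c) d (Cmod_ge_0 c) Hd). lra. }
    assert (He : (0 < eps / B)%R) by (apply Rdiv_lt_0_compat; [apply cond_pos|assumption]).
    generalize (proj1 (filterlim_C _ _ _) Ht (mkposreal _ He)). apply filter_imp.
    simpl. intros k Hk.
    replace (t k * (1 - c / (c + INR k)) - 0) with ((t k - 0) * (1 - c / (c + INR k))) by ring.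
    rewrite Cmod_mult.
    assert (Hb : (Cmod (1 - c / (c + INR k)) <= B)%R).
    { eapply Rle_trans; [apply Cmod_triangle|]. rewrite Cmod_opp, Cmod_1. unfold B.
      apply Rplus_le_compat_l. rewrite Cmod_div by (now apply nonpos_int_nz).
      apply Rmult_le_compat_l; [apply Cmod_ge_0|]. apply Rinv_le_contravar; [assumption|].
      eapply Rle_trans; [apply Rmax_l|apply (Hf k)]. }
    apply Rlt_div_r in Hk; [|assumption].
    eapply Rle_lt_trans; [|exact Hk]. apply Rmult_le_compat_l; [apply Cmod_ge_0|assumption]. }
  assert (Hlim : filterlim (fun N => H (S N)) eventually
    (locally (c * (c + 1) * bailey b c - (c + b) * (c + 1 - b) * bailey b (c + 2)))).
  { eapply filterlim_ext; [exact Hsum|].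
    apply (is_series_minus (V := C_NormedModule) (fun k => c * (c + 1) * t k)
      (fun k => (c + b) * (c + 1 - b) * s k)); apply (is_series_scal (V := C_NormedModule));
    apply is_series_gauss; auto; rewrite Cmod_half; lra. }
  pose proof (filterlim_C_unique _ _ _ _ HH Hlim) as E.
  replace (c * (c + 1) * bailey b c) with ((c * (c + 1) * bailey b c
    - (c + b) * (c + 1 - b) * bailey b (c + 2)) + (c + b) * (c + 1 - b) * bailey b (c + 2)) by ring.
  rewrite <- E; ring.
Qed.

Lemma bailey_continuous {T} (F : (T -> Prop) -> Prop) {FF : ProperFilter F} b c (f : T -> C) :
  ~ nonpos_int c -> filterlim f F (locally c) ->
  filterlim (fun t => bailey b (f t)) F (locally (bailey b c)).
Proof.
  intros Hc Hf. apply (filterlim_gauss F b (1 - b) c f (fun _ => RtoC (1 / 2)%R) _ (1 / 2)%R Hc Hf).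
  - apply filterlim_const.
  - lra.
  - rewrite Cmod_half. apply filter_forall; intros; lra.
Qed.

Lemma bailey_bound b c : ~ nonpos_int c ->
  exists B, locally c (fun c' => forall n, (Cmod (bailey b (c' + INR n)) <= B)%R).
Proof.
  intros Hc. destruct (far_locally c Hc) as [d [K [Hd [_ [_ Hf]]]]].
  exists (Series (gauss_majorant (Cmod b) (Cmod (1 - b)) d K (1 / 2))).
  revert Hf; apply filter_imp; intros c' Hc' n. apply CSeries_bound.
  - apply ex_series_gauss_majorant; auto using Cmod_ge_0; lra.
  - intros k. apply Cmod_gauss_term_le; auto using far_shift; try lra. rewrite Cmod_half; lra.
Qed.

Lemma filterlim_inv_shift (c : C) (f : nat -> nat) :
  filterlim f eventually eventually ->
  filterlim (fun N => / (c + INR (f N))) eventually (locally (RtoC 0)).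
Proof.
  intros Hf. apply (filterlim_comp _ _ _ f (fun N => / (c + INR N)) eventually eventually _ Hf).
  apply (proj2 (filterlim_C _ _ _)); intros eps.
  pose proof (Rinv_0_lt_compat _ (cond_pos eps)) as He.
  destruct (nfloor_ex (Cmod c + / eps)) as [J [_ HJ]].
  { pose proof (Cmod_ge_0 c); lra. }
  exists (J + 1)%nat; intros n Hn. apply le_INR in Hn. rewrite plus_INR in Hn; simpl in Hn.
  pose proof (Cmod_plus_INR_ge c n) as H1.
  assert (H2 : (/ eps < Cmod (c + INR n))%R) by lra.
  assert (H3 : c + INR n <> 0) by (apply Cmod_gt_0; lra).
  replace (/ (c + INR n) - 0) with (/ (c + INR n)) by ring.
  rewrite Cmod_inv by assumption. rewrite <- (Rinv_inv eps). apply Rinv_lt_contravar; [|assumption].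
  apply Rmult_lt_0_compat; lra.
Qed.

(** All terms but the first vanish in the limit. *)
Lemma bailey_lim b c : ~ nonpos_int c ->
  filterlim (fun N => bailey b (c + INR (2 * N))) eventually (locally (RtoC 1)).
Proof.
  intros Hc. destruct (far_locally c Hc) as [d [K [Hd [_ [Hf _]]]]].
  assert (E : CSeries (fun k => if Nat.leb k 0 then RtoC 1 else 0) = 1).
  { rewrite (CSeries_finite (fun _ => RtoC 1) 0). apply sum_O. }
  rewrite <- E.
  apply (tannery eventually (fun k N => gauss_term b (1 - b) (c + INR (2 * N)) (1 / 2)%R k) _
    (gauss_majorant (Cmod b) (Cmod (1 - b)) d K (1 / 2))).
  - apply ex_series_gauss_majorant; auto using Cmod_ge_0; lra.
  - apply filter_forall; intros N k.
    apply Cmod_gauss_term_le; auto using far_shift; try lra. rewrite Cmod_half; lra.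
  - intros k; induction k as [|k IH].
    + apply (filterlim_ext (fun _ => RtoC 1)); [intros; symmetry; apply gauss_term_0|apply filterlim_const].
    + cbn [Nat.leb].
      set (q := (b + INR k) * (1 - b + INR k) * RtoC (1 / 2)%R / (INR k + 1)).
      apply (filterlim_ext (fun N => gauss_term b (1 - b) (c + INR (2 * N)) (1 / 2)%R k
        * (q * / (c + INR k + INR (2 * N))))).
      { intros N. rewrite gauss_term_S by now apply nonpos_int_shift. unfold q.
        pose proof (INR_S_nz k) as H6. rewrite INR_S_C in H6.
        pose proof (nonpos_int_nz _ k (nonpos_int_shift c (2 * N) Hc)) as H7.
        replace (c + INR k + INR (2 * N)) with (c + INR (2 * N) + INR k) by ring.
        f_equal. field; auto. }
      match goal with |- filterlim _ _ (locally ?l) =>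
        replace l with ((if Nat.leb k 0 then RtoC 1 else 0) * (q * 0)) by ring end.
      apply filterlim_Cmult; [typeclasses eauto|exact IH|].
      apply filterlim_Cmult; [typeclasses eauto|apply filterlim_const|].
      apply filterlim_inv_shift. apply eventually_subseq; intros; lia.
Qed.

(** Bailey's theorem in the form of an infinite product, the last factor tending
    to $1$. *)
Lemma bailey_product b c N : ~ nonpos_int c ->
  poch c (2 * N) * bailey b c
  = 4 ^ N * poch ((c + b) / 2) N * poch ((c + 1 - b) / 2) N * bailey b (c + INR (2 * N)).
Proof.
  intros Hc. induction N as [|N IH].
  { simpl. rewrite Cplus_0_r. ring. }
  replace (2 * S N)%nat with (S (S (2 * N))) by lia.
  pose proof (bailey_rec b (c + INR (2 * N)) (nonpos_int_shift c _ Hc)) as R.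
  replace (c + INR (2 * N) + 2) with (c + INR (S (S (2 * N)))) in R by (rewrite !INR_S_C; ring).
  cbn [poch Cpow].
  set (g := bailey b (c + INR (S (S (2 * N))))) in *.
  transitivity ((poch c (2 * N) * bailey b c) * ((c + INR (2 * N)) * (c + INR (2 * N) + 1))).
  { rewrite INR_S_C. ring. }
  rewrite IH.
  transitivity (4 ^ N * poch ((c + b) / 2) N * poch ((c + 1 - b) / 2) N *
    ((c + INR (2 * N)) * (c + INR (2 * N) + 1) * bailey b (c + INR (2 * N)))); [ring|].
  rewrite R, mult_INR, RtoC_mult, INR_2_C. field.
Qed.

(** * Euler's limit for the Gamma function *)

Lemma ex_series_inv_sqr : ex_series (fun n => (/ (INR n + 2) ^ 2)%R).
Proof.
  apply (@ex_series_le R_AbsRing R_CompleteNormedModule _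
    (fun n => / (INR n + 1) - / (INR n + 2))%R).
  - intros n. pose proof (pos_INR n). change norm with Rabs.
    rewrite Rabs_pos_eq by (left; apply Rinv_0_lt_compat, pow_lt; lra).
    replace (/ (INR n + 1) - / (INR n + 2))%R with (/ ((INR n + 1) * (INR n + 2)))%R by (field; lra).
    apply Rinv_le_contravar; nra.
  - exists (1 - 0)%R.
    apply (filterlim_ext (fun n => 1 - / (INR n + 2))%R).
    { induction x as [|n IH]; [rewrite sum_O; simpl; field|].
      rewrite sum_Sn, <- IH, S_INR. unfold plus; simpl. pose proof (pos_INR n).
      replace (INR n + 1 + 1)%R with (INR n + 2)%R by ring. ring. }
    apply (is_lim_seq_minus' (fun _ => 1)%R (fun n => / (INR n + 2))%R); [apply is_lim_seq_const|].
    apply (is_lim_seq_inv _ p_infty); [|discriminate].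
    eapply is_lim_seq_plus; [apply is_lim_seq_INR|apply is_lim_seq_const|reflexivity].
Qed.

Lemma filterlim_unshift (P : nat -> C) l :
  filterlim (fun n => P (S n)) eventually (locally l) -> filterlim P eventually (locally l).
Proof.
  intros H Q HQ. destruct (H Q HQ) as [N HN]. exists (S N); intros [|n] Hn; [lia|].
  apply HN; lia.
Qed.

(** A product with factors $1+e_n$, $\sum|e_n|<\infty$: the partial products are
    bounded by $|P_0|\exp\sum|e_n|$, hence their differences are summable. *)
Lemma infinite_product_converges (P e : nat -> C) K :
  (forall n, P (S n) = P n * (1 + e n)) ->
  (forall n, (Cmod (e n) <= K * / (INR n + 2) ^ 2)%R) ->
  exists l, filterlim P eventually (locally l).
Proof.
  intros HP He. set (w := fun n => (K * / (INR n + 2) ^ 2)%R).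
  change (forall n, (Cmod (e n) <= w n)%R) in He.
  assert (Hw : ex_series w) by exact (ex_series_scal_l K _ ex_series_inv_sqr).
  assert (Hw0 : forall n, (0 <= w n)%R) by (intros n; eapply Rle_trans; [apply Cmod_ge_0|apply He]).
  assert (Hstep : forall n, (Cmod (P (S n)) <= Cmod (P n) * exp (w n))%R).
  { intros n. rewrite HP, Cmod_mult. apply Rmult_le_compat_l; [apply Cmod_ge_0|].
    eapply Rle_trans; [apply Cmod_triangle|]. rewrite Cmod_1.
    specialize (He n). pose proof (exp_ineq1_le (w n)). lra. }
  assert (Hexp : forall n, (Cmod (P (S n)) <= Cmod (P 0%nat) * exp (sum_n w n))%R).
  { induction n as [|n IH]; [rewrite sum_O; apply Hstep|].
    eapply Rle_trans; [apply Hstep|]. rewrite sum_Sn. unfold plus; simpl. rewrite exp_plus, <- Rmult_assoc.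
    apply Rmult_le_compat_r; [left; apply exp_pos|exact IH]. }
  set (B := (Cmod (P 0%nat) * exp (Series w))%R).
  assert (HB : forall n, (Cmod (P n) <= B)%R).
  { assert (Hmono : forall x y, (x <= y)%R -> (exp x <= exp y)%R).
    { intros x y [Hlt| ->]; [left; now apply exp_increasing|apply Rle_refl]. }
    intros [|n].
    - unfold B. rewrite <- (Rmult_1_r (Cmod (P 0%nat))) at 1. apply Rmult_le_compat_l; [apply Cmod_ge_0|].
      rewrite <- exp_0. apply Hmono. eapply Rle_trans; [apply (Hw0 0%nat)|].
      rewrite <- (sum_O w). now apply sum_n_le_Series.
    - eapply Rle_trans; [apply Hexp|]. apply Rmult_le_compat_l; [apply Cmod_ge_0|].
      apply Hmono. now apply sum_n_le_Series. }
  assert (Hser : is_series (fun n => P n * e n) (CSeries (fun n => P n * e n))).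
  { apply (is_CSeries _ (fun n => (B * w n)%R)).
    - exact (ex_series_scal_l B _ Hw).
    - intros n. rewrite Cmod_mult. apply Rmult_le_compat; try apply Cmod_ge_0; [apply HB|apply He]. }
  exists (P 0%nat + CSeries (fun n => P n * e n)). apply filterlim_unshift.
  apply (filterlim_ext (fun n => P 0%nat + sum_n (fun n => P n * e n) n)).
  { induction x as [|n IH]; [rewrite sum_O, HP; ring|].
    rewrite sum_n_S_C, (HP (S n)), <- IH. ring. }
  apply filterlim_Cplus; [typeclasses eauto|apply filterlim_const|exact Hser].
Qed.

(** The binomial series at $z=1/(n+2)$ expands $((n+2)/(n+1))^a$, so this is the
    estimate that makes the products for $\Gamma$ and $1/\Gamma$ converge. *)
Lemma binomial_second_order (a : C) :
  exists K, (0 <= K)%R /\ forall z : R, (0 <= z <= 1 / 2)%R ->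
    (Cmod (Cexp (- a * ln (1 - z)) - (1 + a * z)) <= K * z ^ 2)%R.
Proof.
  set (m := fun n => (4 * gauss_majorant (Cmod a) (Cmod 1) 1 0 (1 / 2) n)%R).
  assert (Hm : ex_series m).
  { refine (ex_series_scal_l 4%R _ (ex_series_gauss_majorant _ _ _ _ _ _ _ _ _));
      auto using Cmod_ge_0; lra. }
  assert (Hm2 : ex_series (fun n => m (2 + n)%nat)) by (apply (ex_series_incr_n m 2), Hm).
  assert (Hle : forall n (z : R), (0 <= z <= 1 / 2)%R ->
     (Cmod (binomial_term a z (2 + n)) <= z ^ 2 * m (2 + n)%nat)%R).
  { intros n z Hz.
    assert (Hg : (Cmod (binomial_term a (1 / 2)%R (2 + n)) <=
                 gauss_majorant (Cmod a) (Cmod 1) 1 0 (1 / 2) (2 + n))%R).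
    { rewrite binomial_term_gauss. apply Cmod_gauss_term_le; auto using far_1; try lra.
      rewrite Cmod_half; lra. }
    unfold m. eapply Rle_trans; [|apply Rmult_le_compat_l; [apply pow2_ge_0|
      apply Rmult_le_compat_l; [lra|exact Hg]]].
    unfold binomial_term. rewrite !Cmod_mult, !Cmod_pow, !Cmod_R, !Rabs_pos_eq by lra.
    rewrite !pow_add.
    assert (Hp : (z ^ n <= (1 / 2) ^ n)%R) by (apply pow_incr; lra).
    pose proof (Cmod_ge_0 (poch a (2 + n) / INR (fact (2 + n)))) as H0.
    set (q := Cmod (poch a (2 + n) / INR (fact (2 + n)))) in *.
    replace (z ^ 2 * (4 * (q * ((1 / 2) ^ 2 * (1 / 2) ^ n))))%R with (q * (z ^ 2 * (1 / 2) ^ n))%R by field.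
    apply Rmult_le_compat_l; [exact H0|]. apply Rmult_le_compat_l; [apply pow2_ge_0|exact Hp]. }
  exists (Series (fun n => m (2 + n)%nat)). split.
  - assert (Hp : forall n, (0 <= m (2 + n)%nat)%R).
    { intros n. pose proof (Hle n (1 / 2)%R ltac:(lra)).
      pose proof (Cmod_ge_0 (binomial_term a (1 / 2)%R (2 + n))). lra. }
    eapply Rle_trans; [exact (Hp 0%nat)|].
    eapply Rle_trans; [|exact (sum_n_le_Series _ 0 Hm2 Hp)]. rewrite sum_O. apply Rle_refl.
  - intros z Hz.
    assert (Hz1 : (0 <= z < 1)%R) by lra.
    pose proof (binomial_series a z Hz1) as Hs.
    assert (Hv : is_series (fun n => binomial_term a z (2 + n)) (Cexp (- a * ln (1 - z)) - (1 + a * z))).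
    { apply (is_series_incr_n (V := C_NormedModule) (binomial_term a z) 2); [lia|].
      simpl pred. rewrite sum_n_S_C, sum_O. unfold binomial_term. simpl.
      match goal with |- is_series _ ?l => replace l with (Cexp (- a * ln (1 - z))); [exact Hs|] end.
      unfold plus; simpl. eqC. field. }
    rewrite <- (CSeries_unique _ _ Hv), Rmult_comm, <- Series_scal_l.
    apply CSeries_bound; [exact (ex_series_scal_l (z ^ 2)%R _ Hm2)|].
    intros n; now apply Hle.
Qed.

Definition euler_term (z : C) (n : nat) : C :=
  INR (fact n) * Cexp (z * ln (INR n)) / poch z (S n).

Lemma euler_term_nz z n : ~ nonpos_int z -> euler_term z n <> 0.
Proof.
  intros Hz. unfold euler_term. apply Cmult_neq_0.
  - apply Cmult_neq_0; [apply fact_nz|apply Cexp_nz].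
  - intros E. apply C1_nz. rewrite <- (Cinv_l (poch z (S n))) by now apply poch_nz. rewrite E; ring.
Qed.

Lemma INR_plus_2_inv n : (0 <= / (INR n + 2) <= 1 / 2)%R.
Proof.
  pose proof (pos_INR n). split; [left; apply Rinv_0_lt_compat; lra|].
  unfold Rdiv; rewrite Rmult_1_l. apply Rinv_le_contravar; lra.
Qed.

Lemma Cexp_ln_step z n :
  Cexp (z * ln (INR (S (S n)))) = Cexp (z * ln (INR (S n))) * Cexp (- z * ln (1 - / (INR n + 2))).
Proof.
  rewrite <- Cexp_plus. f_equal. pose proof (pos_INR n).
  replace (1 - / (INR n + 2))%R with (INR (S n) / INR (S (S n)))%R.
  2: { rewrite !S_INR. field. lra. }
  rewrite ln_div by (apply lt_0_INR; lia). rewrite RtoC_minus. ring.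
Qed.

Lemma euler_term_S z n : ~ nonpos_int z ->
  euler_term z (S (S n)) = euler_term z (S n) *
    ((INR n + 2) * Cexp (- z * ln (1 - / (INR n + 2))) / (z + INR n + 2)).
Proof.
  intros Hz. unfold euler_term. rewrite Cexp_ln_step, (fact_S_C (S n)), INR_S_C.
  cbn [poch]. rewrite !INR_S_C.
  pose proof (poch_nz z n Hz). pose proof (nonpos_int_nz z n Hz).
  pose proof (nonpos_int_nz z (S n) Hz) as H1. rewrite INR_S_C in H1.
  pose proof (nonpos_int_nz z (S (S n)) Hz) as H2. rewrite !INR_S_C in H2.
  replace (INR n + 1 + 1) with (INR n + 2) in * by ring.
  rewrite !Cplus_assoc in *.
  field; repeat split; auto.
Qed.

Lemma RtoC_inv_step n : RtoC (/ (INR n + 2))%R = / (INR n + 2).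
Proof. pose proof (pos_INR n). rewrite RtoC_inv, RtoC_plus by lra. reflexivity. Qed.

Lemma INR_plus_2_nz n : INR n + 2 <> 0.
Proof.
  pose proof (pos_INR n). rewrite <- RtoC_plus. intros E; apply RtoC_inj in E; lra.
Qed.

(** Consecutive terms have ratio $1+O(n^{-2})$. *)
Lemma euler_term_converges z : ~ nonpos_int z ->
  exists l, filterlim (euler_term z) eventually (locally l).
Proof.
  intros Hz. destruct (binomial_second_order z) as [K [HK0 HK]].
  destruct (far_locally z Hz) as [d [K0 [Hd [_ [Hf _]]]]].
  set (r := fun n => Cexp (- z * ln (1 - / (INR n + 2))) - (1 + z * (/ (INR n + 2))%R)).
  destruct (infinite_product_converges (fun n => euler_term z (S n))
    (fun n => (1 - z / (z + INR (S (S n)))) * r n) ((1 + Cmod z / d) * K)) as [l Hl].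
  - intros n. rewrite (euler_term_S z n Hz). unfold r. rewrite RtoC_inv_step.
    pose proof (nonpos_int_nz z (S (S n)) Hz) as H2. rewrite !INR_S_C in *.
    replace (INR n + 1 + 1) with (INR n + 2) in * by ring. rewrite Cplus_assoc in *.
    pose proof (INR_plus_2_nz n). f_equal. field; auto.
  - intros n. rewrite Cmod_mult, Rmult_assoc. apply Rmult_le_compat; try apply Cmod_ge_0.
    + eapply Rle_trans; [apply Cmod_triangle|]. rewrite Cmod_opp, Cmod_1.
      apply Rplus_le_compat_l. rewrite Cmod_div by (now apply nonpos_int_nz).
      apply Rmult_le_compat_l; [apply Cmod_ge_0|]. apply Rinv_le_contravar; [assumption|].
      eapply Rle_trans; [apply Rmax_l|apply (Hf (S (S n)))].
    + rewrite <- pow_inv. unfold r. exact (HK _ (INR_plus_2_inv n)).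
  - exists l. now apply filterlim_unshift.
Qed.

(** The reciprocals converge by the same estimate; this is what shows that the
    Gamma function has no zeros. *)
Lemma euler_term_inv_converges z : ~ nonpos_int z ->
  exists l, filterlim (fun n => / euler_term z n) eventually (locally l).
Proof.
  intros Hz. destruct (binomial_second_order (- z)) as [K [HK0 HK]].
  set (x := fun n => RtoC (/ (INR n + 2))%R).
  set (r := fun n => Cexp (- - z * ln (1 - / (INR n + 2))) - (1 + - z * x n)).
  destruct (infinite_product_converges (fun n => / euler_term z (S n))
    (fun n => (1 + z * x n) * r n - z * z * x n ^ 2) ((1 + Cmod z) * K + Cmod z * Cmod z)) as [l Hl].
  - intros n. rewrite (euler_term_S z n Hz).
    pose proof (nonpos_int_nz z (S (S n)) Hz) as H2. rewrite !INR_S_C in *.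
    replace (INR n + 1 + 1) with (INR n + 2) in * by ring. rewrite Cplus_assoc in *.
    pose proof (INR_plus_2_nz n). pose proof (Cexp_nz (- z * ln (1 - / (INR n + 2)))) as H3.
    pose proof (euler_term_nz z (S n) Hz) as He.
    unfold r. replace (- - z * ln (1 - / (INR n + 2))) with (- (- z * ln (1 - / (INR n + 2)))) by ring.
    replace (Cexp (- (- z * ln (1 - / (INR n + 2))))) with (/ Cexp (- z * ln (1 - / (INR n + 2)))).
    2: { apply (Cmult_reg_l _ _ _ H3). rewrite Cexp_opp. field; auto. }
    unfold x. rewrite RtoC_inv_step. field. repeat split; auto.
  - intros n. pose proof (INR_plus_2_inv n) as Hx.
    assert (Hxm : Cmod (x n) = (/ (INR n + 2))%R).
    { unfold x. rewrite Cmod_R, Rabs_pos_eq; lra. }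
    rewrite <- pow_inv, <- Hxm.
    assert (Hr : (Cmod (r n) <= K * Cmod (x n) ^ 2)%R) by (rewrite Hxm; unfold r, x; exact (HK _ Hx)).
    eapply Rle_trans; [apply Cmod_triangle|]. rewrite Cmod_opp, !Cmod_mult, Cmod_pow.
    assert (H1 : (Cmod (1 + z * x n) <= 1 + Cmod z)%R).
    { eapply Rle_trans; [apply Cmod_triangle|]. rewrite Cmod_1, Cmod_mult.
      pose proof (Cmod_ge_0 z). rewrite Hxm. nra. }
    pose proof (Cmod_ge_0 (1 + z * x n)). pose proof (Cmod_ge_0 (r n)).
    rewrite Rmult_plus_distr_r. apply Rplus_le_compat_r. rewrite Rmult_assoc.
    now apply Rmult_le_compat.
  - exists l. now apply filterlim_unshift.
Qed.

Lemma Gamma_lim z : ~ nonpos_int z ->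
  filterlim (euler_term z) eventually (locally (Gamma z)).
Proof.
  intros Hz. destruct (euler_term_converges z Hz) as [l Hl].
  replace (Gamma z) with l; [exact Hl|]. symmetry. now apply Clim_seq_unique.
Qed.

Lemma Gamma_nz z : ~ nonpos_int z -> Gamma z <> 0.
Proof.
  intros Hz E. destruct (euler_term_inv_converges z Hz) as [l Hl].
  apply C1_nz. apply (filterlim_C_unique eventually (fun _ : nat => RtoC 1)); [apply filterlim_const|].
  replace (RtoC 0) with (Gamma z * l) by (rewrite E; ring).
  apply (filterlim_ext (fun n => euler_term z n * / euler_term z n)).
  { intros n. apply Cinv_r. now apply euler_term_nz. }
  apply filterlim_Cmult; [typeclasses eauto|now apply Gamma_lim|exact Hl].
Qed.

Lemma Gamma_succ z : ~ nonpos_int z -> Gamma (z + 1) = z * Gamma z.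
Proof.
  intros Hz. assert (Hz1 : ~ nonpos_int (z + 1)) by exact (nonpos_int_shift z 1 Hz).
  apply (filterlim_C_unique eventually (euler_term (z + 1))); [now apply Gamma_lim|].
  apply (filterlim_ext_loc (fun n => z * euler_term z n * (1 - (z + 1) * / (z + 1 + INR n)))).
  - exists 1%nat; intros n Hn. unfold euler_term.
    assert (Hn0 : (0 < INR n)%R) by (apply lt_0_INR; lia).
    replace ((z + 1) * ln (INR n)) with (z * ln (INR n) + ln (INR n)) by ring.
    rewrite Cexp_plus, Cexp_RtoC, exp_ln by assumption.
    pose proof (poch_Sl z (S n)) as E. cbn [poch] in E. cbn [poch].
    pose proof (poch_nz z n Hz). pose proof (nonpos_int_nz z n Hz).
    pose proof (poch_nz (z + 1) n Hz1). pose proof (nonpos_int_nz (z + 1) n Hz1).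
    pose proof (nonpos_int_neq0 z Hz).
    replace (poch (z + 1) n * (z + 1 + INR n)) with
      (poch z n * (z + INR n) * (z + INR (S n)) / z) by (rewrite E; field; auto).
    rewrite INR_S_C. replace (z + (INR n + 1)) with (z + 1 + INR n) by ring.
    field; repeat split; auto.
  - replace (z * Gamma z) with (z * Gamma z * (1 + - (z + 1) * 0)) by ring.
    apply filterlim_Cmult; [typeclasses eauto| |].
    + apply filterlim_Cmult; [typeclasses eauto|apply filterlim_const|now apply Gamma_lim].
    + apply (filterlim_ext (fun n => 1 + - (z + 1) * / (z + 1 + INR n))); [intros; ring|].
      apply filterlim_Cplus; [typeclasses eauto|apply filterlim_const|].
      apply filterlim_Cmult; [typeclasses eauto|apply filterlim_const|].
      apply (filterlim_inv_shift (z + 1) (fun n => n)). apply filterlim_id.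
Qed.

(** Euler's limit with $(z)_n$ in place of $(z)_{n+1}$, matching the even number of
    factors in [bailey_product]. *)
Lemma Gamma_lim_poch z : ~ nonpos_int z ->
  filterlim (fun n => INR (fact n) * Cexp ((z - 1) * ln (INR n)) / poch z n) eventually (locally (Gamma z)).
Proof.
  intros Hz.
  apply (filterlim_ext_loc (fun n => euler_term z n * (1 + z * / (0 + INR n)))).
  - exists 1%nat; intros n Hn. unfold euler_term.
    assert (Hn0 : (0 < INR n)%R) by (apply lt_0_INR; lia).
    replace (z * ln (INR n)) with ((z - 1) * ln (INR n) + ln (INR n)) by ring.
    rewrite Cexp_plus, Cexp_RtoC, exp_ln by assumption. cbn [poch].
    pose proof (poch_nz z n Hz). pose proof (nonpos_int_nz z n Hz).
    assert (RtoC (INR n) <> 0) by (intros E; apply RtoC_inj in E; lra).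
    rewrite Cplus_0_l. field; repeat split; auto.
  - replace (Gamma z) with (Gamma z * (1 + z * 0)) by ring.
    apply filterlim_Cmult; [typeclasses eauto|now apply Gamma_lim|].
    apply filterlim_Cplus; [typeclasses eauto|apply filterlim_const|].
    apply filterlim_Cmult; [typeclasses eauto|apply filterlim_const|].
    apply (filterlim_inv_shift 0 (fun n => n)). apply filterlim_id.
Qed.

(** * Kummer's theorem *)

Lemma half_not_nonpos_int a : ~ nonpos_int a -> ~ nonpos_int (a / 2).
Proof.
  intros Ha [k Hk]; apply Ha; exists (2 * k)%nat.
  rewrite mult_INR. replace a with (2 * (a / 2)) by (field; apply C2_nz).
  rewrite Hk, <- RtoC_mult. f_equal. simpl; ring.
Qed.

Lemma poch_double a N : poch a (2 * N) = 4 ^ N * poch (a / 2) N * poch ((a + 1) / 2) N.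
Proof.
  induction N as [|N IH]; [simpl; ring|].
  replace (2 * S N)%nat with (S (S (2 * N))) by lia.
  cbn [poch Cpow]. rewrite IH, INR_S_C, mult_INR, RtoC_mult, INR_2_C. pose proof C2_nz. field; auto.
Qed.

(** In the quotient of Euler's limits, taken at $2N$ for $c$ and $a$ and at $N$ for
    the two others, the factorials cancel, the powers of $N$ combine to $2^{1-b}$
    and the Pochhammer symbols are those of [bailey_product]. *)
Lemma kummer_gamma a b :
  ~ nonpos_int (a - b + 1) -> ~ nonpos_int a -> ~ nonpos_int (a / 2 - b + 1) ->
  2 * (Cexp (- b * ln 2) * bailey b (a - b + 1))
  = Gamma (a - b + 1) * Gamma (a / 2) / (Gamma a * Gamma (a / 2 - b + 1)).
Proof.
  intros Hc Ha Hd. set (c := a - b + 1) in *. set (d := a / 2 - b + 1) in *.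
  pose proof (half_not_nonpos_int a Ha) as Ha2.
  set (g := fun z n => INR (fact n) * Cexp ((z - 1) * ln (INR n)) / poch z n).
  assert (Hev : filterlim (fun N => (2 * N)%nat) eventually eventually)
    by (apply eventually_subseq; intros; lia).
  assert (Hg2 : forall z, ~ nonpos_int z -> filterlim (fun N => g z (2 * N)%nat) eventually (locally (Gamma z))).
  { intros z Hz. exact (filterlim_comp _ _ _ _ (g z) _ _ _ Hev (Gamma_lim_poch z Hz)). }
  apply (filterlim_C_unique eventually (fun N =>
    g c (2 * N)%nat * g (a / 2) N / (g a (2 * N)%nat * g d N) * bailey b (c + INR (2 * N)))).
  - apply (filterlim_ext_loc (fun _ => 2 * (Cexp (- b * ln 2) * bailey b c))); [|apply filterlim_const].
    exists 1%nat; intros N HN.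
    pose proof (bailey_product b c N Hc) as P.
    replace (c + b) with (a + 1) in P by (unfold c; ring).
    replace ((c + 1 - b) / 2) with d in P by (unfold c, d; field; apply C2_nz).
    pose proof (poch_double a N) as Q.
    pose proof (poch_nz c (2 * N) Hc). pose proof (poch_nz a (2 * N) Ha) as Hpa.
    pose proof (poch_nz d N Hd). pose proof (poch_nz (a / 2) N Ha2).
    set (G := bailey b (c + INR (2 * N))) in *.
    assert (HN0 : (0 < INR N)%R) by (apply lt_0_INR; lia).
    assert (Hexp : 2 * Cexp (- b * ln 2) * (Cexp ((a - 1) * ln (INR (2 * N))) * Cexp ((d - 1) * ln (INR N)))
       = Cexp ((c - 1) * ln (INR (2 * N))) * Cexp ((a / 2 - 1) * ln (INR N))).
    { replace (RtoC 2) with (Cexp (ln 2)) at 1 by (rewrite Cexp_RtoC, exp_ln by lra; reflexivity).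
      rewrite <- !Cexp_plus. f_equal.
      rewrite mult_INR, ln_mult by (simpl; lra). replace (INR 2) with 2%R by (simpl; ring).
      rewrite RtoC_plus. unfold c, d. field. }
    unfold g.
    transitivity (bailey b c * (Cexp ((c - 1) * ln (INR (2 * N))) * Cexp ((a / 2 - 1) * ln (INR N)))
      / (Cexp ((a - 1) * ln (INR (2 * N))) * Cexp ((d - 1) * ln (INR N)))).
    + rewrite <- Hexp. field. split; apply Cexp_nz.
    + pose proof (Cexp_nz ((a - 1) * ln (INR (2 * N)))). pose proof (Cexp_nz ((d - 1) * ln (INR N))).
      pose proof (fact_nz N). pose proof (fact_nz (2 * N)).
      replace (bailey b c) with (poch a (2 * N) * poch d N * G / (poch (a / 2) N * poch c (2 * N))).
      * field. repeat split; auto.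
      * apply (Cmult_reg_l (poch c (2 * N))); [assumption|]. rewrite P, Q. field. split; auto.
  - match goal with |- filterlim _ _ (locally ?l) => rewrite <- (Cmult_1_r l) end.
    apply filterlim_Cmult; [typeclasses eauto| |now apply bailey_lim].
    apply filterlim_Cdiv; [typeclasses eauto|apply Cmult_neq_0; now apply Gamma_nz| |].
    + apply filterlim_Cmult; [typeclasses eauto|now apply Hg2|exact (Gamma_lim_poch _ Ha2)].
    + apply filterlim_Cmult; [typeclasses eauto|now apply Hg2|exact (Gamma_lim_poch _ Hd)].
Qed.

(** * The coefficients of $\Phi_1[a,b;a-b+1;-1,y]$ *)

(** The coefficient of $y^n/n!$, with the value of ${}_2F_1$ at $-1$ inserted. In
    this form it is meaningful whenever $a-b+1$ is not a nonpositive integer. *)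
Definition humbert_coef (a b : C) (n : nat) : C :=
  poch a n / poch (a - b + 1) n * (Cexp (- b * ln 2) * bailey b (a - b + 1 + INR n)).

Lemma Phi1_humbert_coef F a b y : principal_2F1 F -> ~ nonpos_int (a - b + 1) ->
  Phi1 F a b (a - b + 1) (-1) y = CSeries (fun n => humbert_coef a b n * (y ^ n / INR (fact n))).
Proof.
  intros HF Hc. apply CSeries_ext; intros n.
  rewrite (principal_2F1_at_m1 F) by (auto using nonpos_int_shift).
  unfold humbert_coef, bailey.
  now replace (a - b + 1 + INR n - (a + INR n)) with (1 - b) by ring.
Qed.

(** The recurrence for $g$ at $c+n$, where $c+n+b=a+n+1$ cancels the last factor of
    $(a)_{n+2}$. *)
Lemma humbert_coef_rec a b n : ~ nonpos_int (a - b + 1) ->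
  humbert_coef a b (S (S n)) * (a / 2 - b + 1 + INR n / 2)
  = humbert_coef a b n * (a / 2 + INR n / 2).
Proof.
  intros Hc. unfold humbert_coef. set (c := a - b + 1) in *.
  pose proof (bailey_rec b (c + INR n) (nonpos_int_shift c n Hc)) as R.
  replace (c + INR n + 2) with (c + INR (S (S n))) in R by (rewrite !INR_S_C; ring).
  set (g := bailey b (c + INR (S (S n)))) in *. set (h := bailey b (c + INR n)) in *.
  pose proof (poch_nz c n Hc). pose proof (nonpos_int_nz c n Hc) as H1.
  pose proof (nonpos_int_nz c (S n) Hc) as H2. rewrite INR_S_C in H2.
  cbn [poch]. rewrite INR_S_C. pose proof C2_nz.
  replace (c + INR n + 1) with (c + (INR n + 1)) in R by ring.
  replace h with ((c + INR n + b) * (c + (INR n + 1) - b) * g / ((c + INR n) * (c + (INR n + 1)))).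
  2: { apply (Cmult_reg_l ((c + INR n) * (c + (INR n + 1)))); [now apply Cmult_neq_0|].
       rewrite R. unfold c in *. field; auto. }
  replace (c + INR n + b) with (a + INR n + 1) by (unfold c; ring).
  replace (c + (INR n + 1) - b) with (2 * (a / 2 - b + 1 + INR n / 2)) by (unfold c; field; auto).
  field. repeat split; auto.
Qed.

Lemma humbert_coef_even a b m : ~ nonpos_int (a - b + 1) -> ~ nonpos_int (a / 2 - b + 1) ->
  humbert_coef a b (2 * m) = humbert_coef a b 0 * (poch (a / 2) m / poch (a / 2 - b + 1) m).
Proof.
  intros Hc Hd. induction m as [|m IH]; [change (2 * 0)%nat with 0%nat; cbn [poch]; field|].
  replace (2 * S m)%nat with (S (S (2 * m))) by lia.
  pose proof (humbert_coef_rec a b (2 * m) Hc) as R. rewrite IH in R.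
  replace (INR (2 * m) / 2) with (RtoC (INR m)) in R
    by (rewrite mult_INR, RtoC_mult, INR_2_C; field; apply C2_nz).
  pose proof (poch_nz _ m Hd). pose proof (nonpos_int_nz _ m Hd) as H1.
  apply (Cmult_reg_l _ _ _ H1). rewrite Cmult_comm, R. cbn [poch].
  set (e := a / 2 - b + 1) in *. field; auto.
Qed.

Lemma humbert_coef_odd a b m : ~ nonpos_int (a - b + 1) -> ~ nonpos_int (a / 2 - b + 3 / 2) ->
  humbert_coef a b (2 * m + 1)
  = humbert_coef a b 1 * (poch (a / 2 + 1 / 2) m / poch (a / 2 - b + 3 / 2) m).
Proof.
  intros Hc Hd. induction m as [|m IH]; [change (2 * 0 + 1)%nat with 1%nat; cbn [poch]; field|].
  replace (2 * S m + 1)%nat with (S (S (2 * m + 1))) by lia.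
  pose proof (humbert_coef_rec a b (2 * m + 1) Hc) as R. rewrite IH in R.
  replace (INR (2 * m + 1) / 2) with (INR m + 1 / 2) in R
    by (rewrite plus_INR, mult_INR, RtoC_plus, RtoC_mult, INR_2_C; simpl INR; field; apply C2_nz).
  replace (a / 2 - b + 1 + (INR m + 1 / 2)) with (a / 2 - b + 3 / 2 + INR m) in R by (field; apply C2_nz).
  replace (a / 2 + (INR m + 1 / 2)) with (a / 2 + 1 / 2 + INR m) in R by ring.
  pose proof (poch_nz _ m Hd). pose proof (nonpos_int_nz _ m Hd) as H1.
  apply (Cmult_reg_l _ _ _ H1). rewrite Cmult_comm, R. cbn [poch].
  set (e := a / 2 - b + 3 / 2) in *. field; auto.
Qed.

Lemma humbert_coef_0 a b :
  ~ nonpos_int (a - b + 1) -> ~ nonpos_int a -> ~ nonpos_int (a / 2 - b + 1) ->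
  humbert_coef a b 0
  = Gamma (a - b + 1) / (2 * Gamma a) * (Gamma (a / 2) / Gamma (a / 2 - b + 1)).
Proof.
  intros Hc Ha Hd. pose proof (kummer_gamma a b Hc Ha Hd) as K.
  pose proof (Gamma_nz _ Ha). pose proof (Gamma_nz _ Hd). pose proof C2_nz.
  unfold humbert_coef. cbn [poch]. simpl INR. rewrite Cplus_0_r.
  apply (Cmult_reg_l 2); [assumption|].
  transitivity (2 * (Cexp (- b * ln 2) * bailey b (a - b + 1))); [field|].
  rewrite K. field; auto.
Qed.

(** Kummer's formula for $a+1$ in place of $a$, brought back to $a$ by the functional
    equation. *)
Lemma humbert_coef_1 a b :
  ~ nonpos_int (a - b + 1) -> ~ nonpos_int a -> ~ nonpos_int (a / 2 - b + 3 / 2) ->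
  humbert_coef a b 1
  = Gamma (a - b + 1) / (2 * Gamma a) * (Gamma (a / 2 + 1 / 2) / Gamma (a / 2 - b + 3 / 2)).
Proof.
  intros Hc Ha Hd. pose proof C2_nz.
  pose proof (nonpos_int_shift _ 1 Hc) as Hc1. pose proof (nonpos_int_shift _ 1 Ha) as Ha1.
  simpl INR in Hc1, Ha1.
  pose proof (kummer_gamma (a + 1) b) as K.
  replace (a + 1 - b + 1) with (a - b + 1 + 1) in K by ring.
  replace ((a + 1) / 2 - b + 1) with (a / 2 - b + 3 / 2) in K by (field; auto).
  replace ((a + 1) / 2) with (a / 2 + 1 / 2) in K by (field; auto).
  specialize (K Hc1 Ha1 Hd). rewrite (Gamma_succ _ Ha), (Gamma_succ _ Hc) in K.
  pose proof (Gamma_nz _ Ha). pose proof (Gamma_nz _ Hd).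
  pose proof (nonpos_int_neq0 _ Ha). pose proof (nonpos_int_neq0 _ Hc).
  unfold humbert_coef. cbn [poch]. simpl INR. rewrite !Cplus_0_r.
  apply (Cmult_reg_l 2); [assumption|].
  transitivity (a / (a - b + 1) * (2 * (Cexp (- b * ln 2) * bailey b (a - b + 1 + 1)))); [field; auto|].
  rewrite K. field; repeat split; auto.
Qed.

Lemma filterlim_lower_parameter (a b : C) :
  filterlim (fun a' => a' - b + 1) (locally a) (locally (a - b + 1)).
Proof.
  apply filterlim_Cplus; [typeclasses eauto| |apply filterlim_const].
  apply filterlim_Cplus; [typeclasses eauto|apply filterlim_id|apply filterlim_const].
Qed.

(** Uniformity for parameters near $a$ gives both convergence at $a$ and
    continuity in $a$. *)
Lemma humbert_majorant a b y : ~ nonpos_int (a - b + 1) ->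
  exists M, ex_series M /\ locally a (fun a' => forall n,
    (Cmod (humbert_coef a' b n * (y ^ n / INR (fact n))) <= M n)%R).
Proof.
  intros Hc.
  pose proof (filterlim_lower_parameter a b) as Hlim.
  destruct (far_locally _ Hc) as [d [K [Hd [_ [_ Hf]]]]].
  destruct (bailey_bound b _ Hc) as [B HB].
  assert (Hf' : locally a (fun a' => far d K (a' - b + 1))) by exact (Hlim _ Hf).
  assert (HB' : locally a (fun a' => forall n, (Cmod (bailey b (a' - b + 1 + INR n)) <= B)%R))
    by exact (Hlim _ HB).
  assert (Ha' : locally a (fun a' => (Cmod a' <= Cmod a + 1)%R)).
  { generalize (proj1 (filterlim_C (locally a) (fun t => t) a) (filterlim_id _ _) (mkposreal 1 Rlt_0_1)).
    apply filter_imp; simpl; intros t Ht. pose proof (Cmod_le_dist t a) as H1.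
    rewrite <- Cmod_opp in Ht. replace (- (t - a)) with (a - t) in Ht by ring. lra. }
  set (s := (Cmod a + 1)%R). pose proof (Cmod_ge_0 a). pose proof (Cmod_ge_0 y).
  set (q := fun j => ((Cmod y + 1) / (INR j + 1))%R).
  assert (Hq0 : forall j, (0 < q j)%R).
  { intros j. pose proof (pos_INR j). apply Rdiv_lt_0_compat; lra. }
  exists (fun n => (rprod (fun j => ratio_majorant s d K j * q j) n * (Cmod (Cexp (- b * ln 2)) * B))%R).
  split.
  - apply ex_series_scal_r. apply (ex_series_rprod _ (1 * 0)); [| |lra].
    + intros j. apply Rmult_lt_0_compat; [apply ratio_majorant_pos; unfold s; lra|apply Hq0].
    + apply is_lim_seq_mult'; [apply is_lim_seq_ratio_majorant|].
      replace (Finite 0) with (Finite ((Cmod y + 1) * 0)) by (f_equal; ring).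
      apply is_lim_seq_mult'; [apply is_lim_seq_const|].
      apply (is_lim_seq_inv _ p_infty); [|discriminate].
      eapply is_lim_seq_plus; [apply is_lim_seq_INR|apply is_lim_seq_const|reflexivity].
  - generalize (filter_and _ _ Ha' (filter_and _ _ Hf' HB')). apply filter_imp.
    intros a' [H1 [H2 H3]] n. unfold humbert_coef.
    rewrite rprod_mult, !Cmod_mult.
    assert (Hy : (Cmod (y ^ n / INR (fact n)) <= rprod q n)%R).
    { induction n as [|n IH].
      - simpl. replace (1 / 1) with (RtoC 1) by field. rewrite Cmod_1; lra.
      - rewrite fact_S_C, Cpow_S. cbn [rprod].
        pose proof (INR_S_nz n) as Hn. rewrite INR_S_C in Hn. pose proof (fact_nz n).
        replace (y * y ^ n / ((INR n + 1) * INR (fact n)))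
          with (y ^ n / INR (fact n) * (y / (INR n + 1))) by (field; auto).
        rewrite Cmod_mult. apply Rmult_le_compat; try apply Cmod_ge_0; [exact IH|].
        rewrite Cmod_div by assumption. rewrite <- RtoC_plus, Cmod_R.
        pose proof (pos_INR n). rewrite Rabs_pos_eq by lra. unfold q.
        apply Rmult_le_compat_r; [left; apply Rinv_0_lt_compat|]; lra. }
    pose proof (Cmod_poch_ratio_le a' _ s d K n H1 Hd H2) as Hp. specialize (H3 n).
    set (A1 := Cmod (poch a' n / poch (a' - b + 1) n)) in *.
    set (A2 := Cmod (bailey b (a' - b + 1 + INR n))) in *.
    set (A3 := Cmod (y ^ n / INR (fact n))) in *.
    replace (A1 * (Cmod (Cexp (- b * ln 2)) * A2) * A3)%R
      with ((A1 * A3) * (Cmod (Cexp (- b * ln 2)) * A2))%R by ring.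
    apply Rmult_le_compat.
    + apply Rmult_le_pos; apply Cmod_ge_0.
    + apply Rmult_le_pos; apply Cmod_ge_0.
    + apply Rmult_le_compat; auto; apply Cmod_ge_0.
    + apply Rmult_le_compat_l; [apply Cmod_ge_0|assumption].
Qed.

Lemma humbert_continuous a b y : ~ nonpos_int (a - b + 1) ->
  filterlim (fun a' => CSeries (fun n => humbert_coef a' b n * (y ^ n / INR (fact n))))
    (locally a) (locally (CSeries (fun n => humbert_coef a b n * (y ^ n / INR (fact n))))).
Proof.
  intros Hc. destruct (humbert_majorant a b y Hc) as [M [HM Hb]].
  apply (tannery (locally a) (fun n a' => humbert_coef a' b n * (y ^ n / INR (fact n))) _ M HM Hb).
  intros n.
  pose proof (filterlim_lower_parameter a b) as Hlim.
  assert (Hpoch : forall (f : C -> C) l, filterlim f (locally a) (locally l) ->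
    filterlim (fun a' => poch (f a') n) (locally a) (locally (poch l n))).
  { intros f l Hf. clear Hb. induction n; cbn [poch]; [apply filterlim_const|].
    apply filterlim_Cmult; [typeclasses eauto|assumption|].
    apply filterlim_Cplus; [typeclasses eauto|assumption|apply filterlim_const]. }
  apply filterlim_Cmult; [typeclasses eauto| |apply filterlim_const].
  unfold humbert_coef. apply filterlim_Cmult; [typeclasses eauto| |].
  - apply filterlim_Cdiv; [typeclasses eauto|now apply poch_nz|now apply Hpoch|now apply Hpoch].
  - apply filterlim_Cmult; [typeclasses eauto|apply filterlim_const|].
    apply bailey_continuous; [typeclasses eauto|now apply nonpos_int_shift|].
    apply filterlim_Cplus; [typeclasses eauto|assumption|apply filterlim_const].
Qed.

(** * Even and odd parts *)

Lemma ex_series_subseq (M : nat -> R) (i : nat) :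
  ex_series M -> (forall n, (0 <= M n)%R) -> ex_series (fun m => M (2 * m + i)%nat).
Proof.
  intros HM H0.
  assert (Hle : forall N, (sum_n (fun m => M (2 * m + i)%nat) N <= sum_n M (2 * N + i))%R).
  { induction N as [|N IH].
    - rewrite sum_O. simpl. destruct i as [|i]; [rewrite sum_O; lra|].
      rewrite sum_Sn. unfold plus; simpl.
      assert (Hp : (0 <= sum_n M i)%R).
      { clear -H0. induction i; [rewrite sum_O; apply H0|]. rewrite sum_Sn. unfold plus; simpl.
        specialize (H0 (S i)). lra. }
      lra.
    - replace (2 * S N + i)%nat with (S (S (2 * N + i))) by lia. rewrite !sum_Sn.
      replace (2 * S N + i)%nat with (S (S (2 * N + i))) by lia. unfold plus; simpl plus.
      specialize (H0 (S (2 * N + i))). unfold plus in *; simpl in *. lra. }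
  apply (ex_finite_lim_seq_incr _ (Series M)).
  - intros n. rewrite sum_Sn. unfold plus; simpl. specialize (H0 (S (n + S (n + 0)) + i)%nat). simpl in *. lra.
  - intros n. eapply Rle_trans; [apply Hle|]. now apply sum_n_le_Series.
Qed.

Lemma CSeries_even_odd (u : nat -> C) (M : nat -> R) :
  ex_series M -> (forall n, (Cmod (u n) <= M n)%R) ->
  CSeries u = CSeries (fun m => u (2 * m)%nat) + CSeries (fun m => u (2 * m + 1)%nat).
Proof.
  intros HM Hu.
  assert (H0 : forall n, (0 <= M n)%R) by (intros; eapply Rle_trans; [apply Cmod_ge_0|apply Hu]).
  assert (E0 : is_series (fun m => u (2 * m)%nat) (CSeries (fun m => u (2 * m)%nat))).
  { apply (is_CSeries _ _ (ex_series_subseq M 0 HM H0)). intros n. rewrite Nat.add_0_r. apply Hu. }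
  assert (E1 : is_series (fun m => u (2 * m + 1)%nat) (CSeries (fun m => u (2 * m + 1)%nat))).
  { apply (is_CSeries _ _ (ex_series_subseq M 1 HM H0)). intros n; apply Hu. }
  apply (filterlim_C_unique eventually (fun N => sum_n u (2 * N + 1))).
  - apply (filterlim_comp _ _ _ (fun N => (2 * N + 1)%nat) (sum_n u) eventually eventually);
      [apply eventually_subseq; intros; lia|exact (is_CSeries u M HM Hu)].
  - apply (filterlim_ext (fun N => sum_n (fun m => u (2 * m)%nat) N + sum_n (fun m => u (2 * m + 1)%nat) N)).
    { induction x as [|N IH]; [change (2 * 0 + 1)%nat with 1%nat; now rewrite sum_n_S_C, !sum_O|].
      replace (2 * S N + 1)%nat with (S (S (2 * N + 1))) by lia.
      rewrite !sum_n_S_C, <- IH. replace (2 * S N)%nat with (S (2 * N + 1)) by lia.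
      replace (S (2 * N + 1) + 1)%nat with (S (S (2 * N + 1))) by lia. ring. }
    apply filterlim_Cplus; [typeclasses eauto|exact E0|exact E1].
Qed.

Lemma pos_not_nonpos_int (x : R) : (0 < x)%R -> ~ nonpos_int x.
Proof.
  intros Hx [j Hj]. apply RtoC_inj in Hj. pose proof (pos_INR j). lra.
Qed.

Lemma fact_double m : RtoC (INR (fact (2 * m))) = 4 ^ m * INR (fact m) * poch (1 / 2) m.
Proof.
  rewrite <- !poch_1, poch_double. replace ((1 + 1) / 2) with (RtoC 1) by (field; apply C2_nz). ring.
Qed.

Lemma fact_double_S m : RtoC (INR (fact (2 * m + 1))) = 4 ^ m * INR (fact m) * poch (3 / 2) m.
Proof.
  rewrite Nat.add_1_r, fact_S_C, fact_double.
  pose proof (poch_Sl (1 / 2) m) as E. cbn [poch] in E.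
  replace (1 / 2 + 1) with (3 / 2) in E by (field; apply C2_nz).
  rewrite mult_INR, RtoC_mult, INR_2_C.
  replace ((2 * INR m + 1) * (4 ^ m * INR (fact m) * poch (1 / 2) m))
    with (2 * (4 ^ m * INR (fact m)) * (poch (1 / 2) m * (1 / 2 + INR m))) by (field; apply C2_nz).
  rewrite E. field; apply C2_nz.
Qed.

(** Convergence is asked of the scaled series, which is the one that is known to
    converge where the lemma is used; if $k=0$ both sides vanish. *)
Lemma CSeries_scal (k : C) (u : nat -> C) :
  (exists l : C, is_series (fun n => k * u n) l) -> CSeries (fun n => k * u n) = k * CSeries u.
Proof.
  intros [l Hl]. destruct (Ceq_dec k 0) as [->|Hk].
  - rewrite Cmult_0_l. rewrite (CSeries_ext _ (fun n => if Nat.leb n 0 then 0 else 0)).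
    + rewrite (CSeries_finite (fun _ => RtoC 0) 0). apply sum_O.
    + intros n; destruct (Nat.leb n 0); ring.
  - rewrite (CSeries_unique _ _ Hl), (CSeries_unique u (/ k * l)); [eqC; field; auto|].
    apply (is_series_ext (fun n => scal (/ k) (k * u n))).
    + intros n. change (/ k * (k * u n) = u n). field; auto.
    + exact (is_series_scal (V := C_NormedModule) (/ k) _ l Hl).
Qed.

(** * The evaluation of $\Phi_1$ *)

Theorem mainTheorem13 :
  forall F : C -> C -> C -> C -> C, principal_2F1 F ->
  forall a b y : C,
  (Re b < 1)%R ->
  ~ nonpos_int (a - b + 1) ->
  let rhs := fun a : C =>
    Gamma (a - b + 1) / (2 * Gamma a) *
    (Gamma (a / 2) / Gamma (a / 2 - b + 1)
       * pFq [a / 2] [1 / 2; a / 2 - b + 1] (y ^ 2 / 4)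
     + Gamma (a / 2 + 1 / 2) / Gamma (a / 2 - b + 3 / 2)
       * y * pFq [a / 2 + 1 / 2] [3 / 2; a / 2 - b + 3 / 2] (y ^ 2 / 4)) in
  let rhs_defined := fun a : C =>
    ~ nonpos_int a /\ ~ nonpos_int (a / 2 - b + 1) /\
    ~ nonpos_int (a / 2 - b + 3 / 2) in
  (rhs_defined a -> Phi1 F a b (a - b + 1) (-1) y = rhs a) /\
  filterlim rhs (within rhs_defined (locally a))
    (locally (Phi1 F a b (a - b + 1) (-1) y)).
Proof.
  intros F HF a b y _ Hc rhs rhs_defined.
  assert (Heq : forall a, ~ nonpos_int (a - b + 1) -> rhs_defined a ->
    CSeries (fun n => humbert_coef a b n * (y ^ n / INR (fact n))) = rhs a).
  { clear a Hc. intros a Hc (Ha & Hd & Hd').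
    destruct (humbert_majorant a b y Hc) as [M [HM Hb]].
    apply locally_singleton in Hb.
    rewrite (CSeries_even_odd _ M HM Hb).
    assert (Hhalf : RtoC (1 / 2)%R = 1 / 2) by (rewrite RtoC_div by lra; reflexivity).
    assert (H32 : RtoC (3 / 2)%R = 3 / 2) by (rewrite RtoC_div by lra; reflexivity).
    assert (Hev : forall m, humbert_coef a b (2 * m) * (y ^ (2 * m) / INR (fact (2 * m)))
      = humbert_coef a b 0 * (Cprod (map (fun a => poch a m) [a / 2])
          / Cprod (map (fun b => poch b m) [1 / 2; a / 2 - b + 1])
          * ((y ^ 2 / 4) ^ m / INR (fact m)))).
    { intros m. rewrite humbert_coef_even, fact_double, Cpow_mult_r by assumption.
      unfold Cprod; cbn [map fold_right].
      replace (y ^ 2 / 4) with (y ^ 2 * / 4) by reflexivity. rewrite Cpow_mult_l, Cpow_inv.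
      2: { intros E; apply RtoC_inj in E; lra. }
      assert (H1 : poch (1 / 2) m <> 0).
      { rewrite <- Hhalf. apply poch_nz, pos_not_nonpos_int. lra. }
      pose proof (poch_nz _ m Hd). pose proof (fact_nz m).
      assert (H4 : 4 ^ m <> 0) by (apply Cpow_nz; intros E; apply RtoC_inj in E; lra).
      field. repeat split; auto. }
    assert (Hod : forall m, humbert_coef a b (2 * m + 1) * (y ^ (2 * m + 1) / INR (fact (2 * m + 1)))
      = humbert_coef a b 1 * y * (Cprod (map (fun a => poch a m) [a / 2 + 1 / 2])
          / Cprod (map (fun b => poch b m) [3 / 2; a / 2 - b + 3 / 2])
          * ((y ^ 2 / 4) ^ m / INR (fact m)))).
    { intros m. rewrite humbert_coef_odd, fact_double_S, Cpow_add_r, Cpow_mult_r, Cpow_1_r by assumption.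
      unfold Cprod; cbn [map fold_right].
      replace (y ^ 2 / 4) with (y ^ 2 * / 4) by reflexivity. rewrite Cpow_mult_l, Cpow_inv.
      2: { intros E; apply RtoC_inj in E; lra. }
      assert (H1 : poch (3 / 2) m <> 0).
      { rewrite <- H32. apply poch_nz, pos_not_nonpos_int. lra. }
      pose proof (poch_nz _ m Hd'). pose proof (fact_nz m).
      assert (H4 : 4 ^ m <> 0) by (apply Cpow_nz; intros E; apply RtoC_inj in E; lra).
      field. repeat split; auto. }
    rewrite (CSeries_ext _ _ Hev), (CSeries_ext _ _ Hod).
    rewrite !CSeries_scal.
    - unfold rhs, pFq. rewrite humbert_coef_0, humbert_coef_1 by assumption. ring.
    - eexists. eapply is_series_ext; [exact Hod|].
      apply (is_CSeries _ (fun m => M (2 * m + 1)%nat)); [|intros; apply Hb].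
      apply ex_series_subseq; [assumption|].
      intros n; eapply Rle_trans; [apply Cmod_ge_0|apply Hb].
    - eexists. eapply is_series_ext; [exact Hev|].
      apply (is_CSeries _ (fun m => M (2 * m + 0)%nat)).
      + apply ex_series_subseq; [assumption|].
        intros n; eapply Rle_trans; [apply Cmod_ge_0|apply Hb].
      + intros n. rewrite Nat.add_0_r. apply Hb. }
  rewrite Phi1_humbert_coef by assumption.
  split; [now apply Heq|].
  destruct (far_locally _ Hc) as [d [K [Hd [_ [_ Hf]]]]].
  pose proof (filterlim_lower_parameter a b) as Hlim.
  apply (filterlim_ext_loc (fun a' => CSeries (fun n => humbert_coef a' b n * (y ^ n / INR (fact n))))).
  - assert (Hf' : locally a (fun a' => far d K (a' - b + 1))) by exact (Hlim _ Hf).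
    unfold within. revert Hf'. apply filter_imp. intros a' Ha' Hdef.
    apply Heq; [|exact Hdef]. exact (far_not_nonpos d K _ Hd Ha').
  - apply (filterlim_filter_le_1 (F := locally a)); [apply filter_le_within|].
    now apply humbert_continuous.
Qed.
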